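(* Let $K$ be a field, let $S=K[x_1,x_2,\ldots,x_n]$ with $n\leq 5$ be a polynomial ring over $K$, and let $I\subset S$ be a monomial ideal such that all associated prime ideals of $S/I$ have height $2$. Then $I$ is a Stanley ideal.
   Context: Let $S=K[x_1,\ldots,x_n]$ be a polynomial ring over a field $K$ and $I\subset S$ a monomial ideal (an ideal generated by monomials). For a monomial $u\in S$ and a subset $Z\subseteq\{x_1,\ldots,x_n\}$, $uK[Z]$ denotes the $K$-vector space spanned by the monomials $uv$ with $v$ a monomial in the variables of $Z$; it is regarded as a subspace of $S/I$ when none of these monomials lies in $I$ (so that their residue classes are linearly independent in $S/I$). A Stanley decomposition of $S/I$ is a decomposition of $S/I$ as a finite direct sum of $K$-vector spaces $$S/I=\bigoplus_{i=1}^r u_iK[Z_i],$$ where each $u_i$ is a monomial in $S$ and each $Z_i\subseteq\{x_1,\ldots,x_n\}$. The ideal $I$ is called a Stanley ideal if there exists a Stanley decomposition $S/I=\bigoplus_{i=1}^r u_iK[Z_i]$ of $S/I$ with $|Z_i|\geq \operatorname{depth}(S/I)$ for all $1\leq i\leq r$. Here $\operatorname{depth}(S/I)$ is the depth of the $S$-module $S/I$ with respect to the graded maximal ideal $(x_1,\ldots,x_n)$. *)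

(* Defs.v *)
From HB Require Import structures.
From mathcomp Require Import all_boot all_order all_algebra.
From mathcomp Require Export mpoly.

Set Implicit Arguments.
Unset Strict Implicit.
Unset Printing Implicit Defensive.

Import GRing.Theory.
Local Open Scope ring_scope.

(* Subsets of a ring, in particular ideals, are arbitrary Prop-valued
   predicates; two of them are compared extensionally. *)

Section Ideals.
Variable R : comNzRingType.
Implicit Types I J P A : R -> Prop.

Definition is_ideal I : Prop :=
  [/\ I 0, forall f g, I f -> I g -> I (f + g) & forall c f, I f -> I (c * f)].

Definition ideal_gen A (f : R) : Prop :=
  exists2 s : seq (R * R),
    (forall p, p \in s -> A p.2) & f = \sum_(p <- s) p.1 * p.2.

Definition is_prime_ideal P : Prop :=
  [/\ is_ideal P, ~ P 1 & forall f g, P (f * g) -> P f \/ P g].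

Definition ideal_proper_sub I J : Prop :=
  (forall f, I f -> J f) /\ exists2 f, J f & ~ I f.

(* c 0 < c 1 < ... < c h = P ; the values c i for i > h are irrelevant. *)
Definition prime_chain P (h : nat) (c : nat -> R -> Prop) : Prop :=
  [/\ forall i, (i <= h)%N -> is_prime_ideal (c i),
      forall i, (i < h)%N -> ideal_proper_sub (c i) (c i.+1)
    & forall f, c h f <-> P f].

Definition has_height P (h : nat) : Prop :=
  (exists c, prime_chain P h c) /\
  (forall k c, prime_chain P k c -> (k <= h)%N).

(* The annihilator of the class of g in R/I is {f | f * g \in I}. *)
Definition associated_prime I P : Prop :=
  is_prime_ideal P /\ exists g : R, forall f, P f <-> I (f * g).

(* (I, fs_0, ..., fs_(i-1)); modulo I it is (fs_0, ..., fs_(i-1)) (R/I). *)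
Definition ideal_add_prefix I (fs : seq R) (i : nat) : R -> Prop :=
  ideal_gen (fun g => I g \/ g \in take i fs).

(* fs is a regular sequence on the R-module R/I: each fs_i is a nonzerodivisor
   on R/(I, fs_0, ..., fs_(i-1)), and R/(I, fs) is nonzero. *)
Definition regular_sequence I (fs : seq R) : Prop :=
  (forall i, (i < size fs)%N -> forall g : R,
     ideal_add_prefix I fs i (fs`_i * g) -> ideal_add_prefix I fs i g) /\
  ~ ideal_add_prefix I fs (size fs) 1.

(* depth of R/I with respect to m is at most k, the depth being the supremum
   of the lengths of the regular sequences on R/I consisting of elements of m.
   Bounding the supremum avoids presupposing that it is finite. *)
Definition depth_le (m : R -> Prop) I (k : nat) : Prop :=
  forall fs : seq R,
    (forall f, f \in fs -> m f) -> regular_sequence I fs -> (size fs <= k)%N.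

End Ideals.

Section Stanley.
Variables (K : fieldType) (n : nat).
Implicit Types (I : {mpoly K[n]} -> Prop) (u m : 'X_{1..n}) (Z : {set 'I_n}).

Definition graded_maximal_ideal : {mpoly K[n]} -> Prop :=
  ideal_gen (fun f => exists i : 'I_n, f = 'X_i).

Definition is_monomial_ideal I : Prop :=
  exists A : 'X_{1..n} -> Prop,
    forall f, I f <-> ideal_gen (fun g => exists2 m, A m & g = 'X_[m]) f.

(* m = u v with v a monomial in the variables of Z. *)
Definition stanley_monomial u Z m : Prop :=
  exists2 v : 'X_{1..n}, (forall i, (0 < v i)%N -> i \in Z) & m = (u + v)%MM.

(* The K-subspace u K[Z] of S: the span of the above monomials. *)
Definition stanley_space u Z (f : {mpoly K[n]}) : Prop :=
  forall m, m \in msupp f -> stanley_monomial u Z m.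

(* S/I is the internal direct sum of the images of the u_i K[Z_i], each of
   which maps injectively to S/I. *)
Definition stanley_decomposition I (r : nat)
    (u : 'I_r -> 'X_{1..n}) (Z : 'I_r -> {set 'I_n}) : Prop :=
  [/\ forall i m, stanley_monomial (u i) (Z i) m -> ~ I 'X_[m],
      forall f : {mpoly K[n]}, exists2 p : 'I_r -> {mpoly K[n]},
        (forall i, stanley_space (u i) (Z i) (p i)) & I (f - \sum_i p i)
    & forall p : 'I_r -> {mpoly K[n]},
        (forall i, stanley_space (u i) (Z i) (p i)) ->
        I (\sum_i p i) -> forall i, I (p i)].

Definition is_stanley_ideal I : Prop :=
  exists r (u : 'I_r -> 'X_{1..n}) (Z : 'I_r -> {set 'I_n}),
    stanley_decomposition I u Z /\
    forall i, depth_le graded_maximal_ideal I #|Z i|.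

End Stanley.

(* Main.v *)
Require Import Defs.
From mathcomp Require Import all_boot all_order all_algebra.
From mathcomp.classical Require Import boolp.
From mathcomp Require Import zify ring.

(** Write [S = K[x_1, ..., x_n]] and let [U] be the set of exponents of the
    monomials of [I].  Since every associated prime of [S/I] is generated by
    two variables, [I] is an intersection of ideals [Q_ij] primary to
    [(x_i, x_j)]: there are staircases [E i j] such that [x^m] lies outside [I]
    exactly when some pair [i, j] satisfies [E i j (m i) (m j)]
    ([monomial_ideal_staircase]).  Every exponent [m] thus carries a graph on
    the [n] variables, with an edge [i j] when [E i j (m i) (m j)]; the graph
    shrinks as [m] grows, and [x^m] survives in [S/I] while it has an edge.
    Both the depth of [S/I] and the Stanley decompositions can be read off
    these graphs.

    Depth.  A regular sequence of length more than [p] kills the Koszul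
    cohomology of [S/I] in degree [p] with respect to powers of the variables
    ([regular_sequence_koszul]), so exhibiting a nonzero class bounds the
    depth.  An edge gives a class in degree [n - 2] ([depth_le_edge]).  The
    graph of [x^m] describes a simplicial complex, whose facets are the
    complements of the edges; two disjoint edges without an edge between them
    make it disconnected up to a cone, and an induced pentagon makes it a
    Moebius strip.  Hence either of them gives a class in degree [n - 3]
    ([depth_le_2K2], [depth_le_C5]).

    Decompositions.  If no graph contains an induced pair of disjoint edges or
    an induced pentagon, then, [n] being at most 5, the complements of all these
    graphs are chordal, and so is the complement of the graph on the pairs (variable, exponent).
    As in the theorem of Dirac on chordal graphs, this graph has a vertex whose
    non-neighbours are pairwise non-adjacent ([cosimplicial_vertex]); removing
    such vertices one after another cuts the monomials outside [I] into pieces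
    with [n - 2] free variables ([tiled_cochordal]).  In the remaining cases
    [n] is 4 or 5 and the depth is at most [n - 3], and sorting the monomials by
    the first edge of their graph yields pieces with [n - 3] free variables
    ([tiled_first_edge]). *)

Set Implicit Arguments.
Unset Strict Implicit.
Unset Printing Implicit Defensive.

Import GRing.Theory.

(** * Graphs whose complement is chordal *)

Section Cosimplicial.
Variables (T : finType) (n : nat) (cell : T -> 'I_n) (h : rel T).
Hypothesis hn : n <= 5.
Hypothesis h_sym : symmetric h.
Hypothesis h_cell : forall x y, cell x = cell y -> ~~ h x y.
Hypothesis h_nested : forall x y, cell x = cell y ->
  (forall z, h x z -> h y z) \/ (forall z, h y z -> h x z).
Hypothesis no2K2 : forall p q r s, h p q -> h r s ->
  ~~ h p r -> ~~ h p s -> ~~ h q r -> ~~ h q s -> False.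
Hypothesis noC5 : forall p q r s t,
  h p q -> h q r -> h r s -> h s t -> h t p ->
  ~~ h p r -> ~~ h p s -> ~~ h q s -> ~~ h q t -> ~~ h r t -> False.

(** [A] is a nonempty union of connected components of the complement of the
    graph, restricted to the neighbourhood of [v]. *)
Definition cocomponents (v : T) (A : {set T}) : bool :=
  [&& A != set0, [forall a in A, h v a]
    & [forall a in A, forall x, (x \notin A) ==> h v x ==> h a x]].

Lemma cocomponentsP (v : T) (A : {set T}) :
  reflect [/\ exists a, a \in A, forall a, a \in A -> h v a
            & forall a x, a \in A -> x \notin A -> h v x -> h a x]
          (cocomponents v A).
Proof.
apply: (iffP and3P) => -[].
  move=> /set0Pn A0 /forall_inP Av /forall_inP AA; split=> // a x aA xA vx.
  by have /forallP/(_ x) := AA a aA; rewrite xA vx.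
move=> /set0Pn A0 Av AA; split=> //; first exact/forall_inP.
apply/forall_inP => a aA; apply/forallP => x.
by apply/implyP => xA; apply/implyP => vx; apply: AA.
Qed.

Lemma diff_cell x y z : h x z -> ~~ h y z -> forall w, h y w -> ~~ h x w ->
  cell x != cell y.
Proof.
move=> xz yz w yw xw; apply/eqP => /h_nested [/(_ _ xz)|/(_ _ yw)].
  by rewrite (negbTE yz).
by rewrite (negbTE xw).
Qed.

(** There are at most five cells. *)
Lemma two_cells (s : seq 'I_n) (x y z : 'I_n) : size s = 3 ->
  uniq [:: x, y & s] -> z \notin s -> (z == x) || (z == y).
Proof.
move=> s3 u zs; apply: contraTT hn => zxy; rewrite -ltnNge.
have uz : uniq [:: z, x, y & s].
  by move: zxy; rewrite negb_or cons_uniq u !inE !negb_or zs => /andP[-> ->].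
by have := uniq_leq_size uz (fun i _ => mem_enum 'I_n i); rewrite size_enum_ord /= s3.
Qed.

(** The border of [A] consists of the vertices outside the neighbourhood of [v]
    that have a non-neighbour in [A].  In the complement, [A] is a component left
    after deleting [v] and its neighbours, and two vertices [b], [b'] of the
    border that are not adjacent there would close a chordless cycle running from
    [v] through [b], [A] and [b'].  Cycles of length 4 and 5 are excluded by
    hypothesis.  Longer ones would have six vertices in pairwise distinct cells,
    since the neighbourhoods in one cell are nested, and there are at most five
    cells. *)
Lemma cocomponents_border_indep (v : T) (A : {set T}) : cocomponents v A ->
  (forall v' A', cocomponents v' A' -> #|A| <= #|A'|) ->
  forall b b', ~~ h v b -> ~~ h v b' -> (exists2 a, a \in A & ~~ h a b) ->
  (exists2 a, a \in A & ~~ h a b') -> ~~ h b b'.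
Proof.
move=> /cocomponentsP[A0 Av AA] Amin b b' vb vb' [a aA ab] [a' aA' ab'].
apply/negP => bb'.
(* By minimality, A is connected in the complement of the graph. *)
have cut (D : {set T}) : D \subset A -> (exists d, d \in D) ->
    (exists2 e, e \in A & e \notin D) ->
    exists d e, [/\ d \in D, e \in A, e \notin D & ~~ h d e].
  move=> /subsetP DA D0 [e eA eD]; apply: contrapT => noDE.
  have : cocomponents v D.
    apply/cocomponentsP; split=> // [d dD|d x dD xD vx]; first exact/Av/DA.
    have [xA|xA] := boolP (x \in A); last by apply: AA => //; apply: DA.
    by apply/negP => /negP dx; apply: noDE; exists d, x.
  move=> /Amin; apply/negP; rewrite -ltnNge; apply: proper_card.
  by apply/properP; split; [apply/subsetP|exists e].
(* A common non-neighbour of b and b' in A would give an induced pair of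
   disjoint edges, and a missing edge between their sets of non-neighbours an
   induced pentagon. *)
have disj d : d \in A -> ~~ h d b -> h d b'.
  move=> dA db; apply/negP => /negP db'.
  exact: (no2K2 (Av d dA) bb').
have disj' d : d \in A -> ~~ h d b' -> h d b.
  by move=> dA; apply: contraR => /disj ->.
have joined d d' : d \in A -> d' \in A -> ~~ h d b -> ~~ h d' b' -> h d d'.
  move=> dA dA' db db'; apply/negP => /negP dd'.
  apply: (@noC5 v d b' b d') => //; first exact: Av.
  - exact: disj.
  - by rewrite h_sym.
  - by rewrite h_sym disj'.
  - by rewrite h_sym Av.
  - by rewrite h_sym.
have neq_adj x y : h x y -> cell x != cell y.
  by move=> xy; apply/eqP => /h_cell; rewrite xy.
have av d : d \in A -> h d v by move=> dA; rewrite h_sym Av.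
have b'b : h b' b by rewrite h_sym.
have cvb : cell v != cell b.
  apply: (@diff_cell v b a _ _ b') => //; first exact: Av.
  by rewrite h_sym.
have cvb' : cell v != cell b'.
  apply: (@diff_cell v b' a' _ _ b) => //; first exact: Av.
  by rewrite h_sym.
have cbb' := neq_adj _ _ bb'.
have border_cell d e : d \in A -> h e b -> h e b' -> ~~ h d e ->
    (~~ h d b) || (~~ h d b') -> cell d \notin [:: cell v; cell b; cell b'].
  move=> dA eb eb' de dbb'; rewrite !inE !negb_or neq_adj ?av //=.
  have [db|db] := boolP (h d b).
    move: dbb'; rewrite db /= => db'; rewrite neq_adj //=.
    apply: (@diff_cell d b' v _ _ e) => //; [exact: av|by rewrite h_sym..].
  rewrite (neq_adj d b') ?disj // andbT.
  apply: (@diff_cell d b v _ _ e) => //; [exact: av|by rewrite h_sym..].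
have inner_cell e : e \in A -> h e b -> h e b' ->
    cell e \notin [:: cell v; cell b; cell b'].
  by move=> eA eb eb'; rewrite !inE !negb_or !neq_adj ?av.
(* By connectedness one can step out of each of the two sets, and the vertex
   reached is adjacent to both b and b'. *)
have [a1 [c [a1A cA a1b [cb cb' a1c]]]] : exists d e, [/\ d \in A, e \in A, ~~ h d b &
    [/\ h e b, h e b' & ~~ h d e]].
  have [|||d [e []]] := cut [set d in A | ~~ h d b].
  - by apply/subsetP => d; rewrite inE => /andP[].
  - by exists a; rewrite inE aA.
  - by exists a'; rewrite // inE aA' /= disj'.
  rewrite !inE => /andP[dA db] eA; rewrite eA /= negbK => eb de.
  exists d, e; split=> //; split=> //.
  by apply: contraR de => eb'; apply: joined.
have [a2 [c' [a2A c'A a2b' [c'b c'b' a2c']]]] : exists d e, [/\ d \in A, e \in A, ~~ h d b' &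
    [/\ h e b, h e b' & ~~ h d e]].
  have [|||d [e []]] := cut [set d in A | ~~ h d b'].
  - by apply/subsetP => d; rewrite inE => /andP[].
  - by exists a'; rewrite inE aA'.
  - by exists a; rewrite // inE aA /= disj.
  rewrite !inE => /andP[dA db'] eA; rewrite eA /= negbK => eb' de.
  exists d, e; split=> //; split=> //.
  by apply: contraR de => eb; rewrite h_sym; apply: joined.
have xy : cell a1 != cell a2 by apply/neq_adj/joined.
have two z : cell z \notin [:: cell v; cell b; cell b'] ->
    (cell z == cell a1) || (cell z == cell a2).
  apply: (two_cells (s := [:: cell v; cell b; cell b'])) => //.
  have X : cell a1 \notin [:: cell v; cell b; cell b'].
    by apply: (border_cell a1 c); rewrite ?a1b.
  have Y : cell a2 \notin [:: cell v; cell b; cell b'].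
    by apply: (border_cell a2 c'); rewrite ?a2b' ?orbT.
  by rewrite /= inE negb_or xy X Y !inE negb_or cvb cvb' cbb'.
have out1 d e : d \in A -> e \in A -> ~~ h d b -> h e b -> ~~ h d e ->
    cell e = cell a1.
  move=> dA eA db eb de.
  have eb' : h e b' by apply: contraR de => eb'; apply: joined.
  have da2 : h d a2 by apply: joined.
  apply/eqP; have /two/orP[//|/eqP ea2] := inner_cell e eA eb eb'.
  suff : cell e != cell a2 by rewrite ea2 eqxx.
  by apply: (@diff_cell e a2 b' _ _ d) => //; rewrite h_sym.
have out2 d e : d \in A -> e \in A -> ~~ h d b' -> h e b' -> ~~ h d e ->
    cell e = cell a2.
  move=> dA eA db' eb' de.
  have eb : h e b by apply: contraR de => eb; rewrite h_sym; apply: joined.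
  have a1d : h a1 d by apply: joined.
  apply/eqP; have /two/orP[/eqP ea1|//] := inner_cell e eA eb eb'.
  suff : cell e != cell a1 by rewrite ea1 eqxx.
  by apply: (@diff_cell e a1 b _ _ d) => //; rewrite h_sym.
(* A cut that separates the two remaining cells: every pair of non-adjacent
   vertices across it would have to lie in one cell. *)
have [|||d [e []]] := cut [set d in A | ~~ h d b || h d b' && (cell d == cell a1)].
- by apply/subsetP => d; rewrite inE => /andP[].
- by exists a1; rewrite inE a1A a1b.
- by exists a2; rewrite // inE a2A disj' //= negb_and a2b'.
rewrite !inE => /andP[dA dD] eA; rewrite eA /= negb_or negbK => /andP[eb eD] de.
have [db|db] := boolP (h d b); last first.
  have ex := out1 d e dA eA db eb de.
  have : h e b' by apply: contraR de => eb'; apply: joined.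
  by move: eD; rewrite ex eqxx andbT => /negbTE ->.
move: dD; rewrite db /= => /andP[db' /eqP dx].
have [eb'|eb'] := boolP (h e b'); last first.
  have := out2 e d eA dA eb' db'; rewrite h_sym => /(_ de) dy.
  by move: xy; rewrite -dx -dy eqxx.
have a1e : ~~ h a1 e.
  apply/negP => a1e.
  suff : cell d != cell a1 by rewrite dx eqxx.
  exact: (@diff_cell d a1 b _ _ e).
by move: eD; rewrite (out1 a1 e) // eb' eqxx.
Qed.

(** Call a vertex cosimplicial when its non-neighbours are pairwise
    non-adjacent.  A minimal choice of [v] and [A] makes every vertex of [A]
    cosimplicial: a vertex of [A] that is adjacent to some vertex of [A] or of its border would
    cut out a smaller choice, so [A] and its border form an independent set, and
    all other vertices are adjacent to all of [A]. *)
Lemma cosimplicial_vertex : (exists x y, h x y) ->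
  exists x, (exists y, h x y) /\ forall y z, ~~ h x y -> ~~ h x z -> ~~ h y z.
Proof.
move=> [x0 [y0 xy0]].
pose P (p : T * {set T}) := cocomponents p.1 p.2.
have P0 : P (x0, [set y | h x0 y]).
  apply/cocomponentsP; split=> [|a|a x]; first by exists y0; rewrite inE.
    by rewrite inE.
  by rewrite !inE => _ /negbTE ->.
case: (arg_minnP (fun p : T * {set T} => #|p.2|) P0) => -[v A]; rewrite /P /= => PA min.
have Amin v' (A' : {set T}) : cocomponents v' A' -> #|A| <= #|A'| by move=> H; apply: (min (v', A') H).
have indep := cocomponents_border_indep PA Amin.
have [[a aA] Av AA] := cocomponentsP _ _ PA.
have smaller w (B : {set T}) : B \subset A -> (exists2 e, e \in A & e \notin B) ->
    ~~ cocomponents w B.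
  move=> BA [e eA eB]; apply/negP => /Amin; apply/negP; rewrite -ltnNge.
  by apply/proper_card/properP; split; last exists e.
have AB x y : x \in A -> ~~ h v y -> (exists2 e, e \in A & ~~ h e y) -> ~~ h x y.
  move=> xA vy ey; apply/negP => xy.
  have [e eA eyN] := ey.
  have /negP[] : ~~ cocomponents y [set z in A | h z y].
    apply: smaller; first by apply/subsetP => z; rewrite inE => /andP[].
    by exists e; rewrite // inE eA.
  apply/cocomponentsP; split=> [|z|z w].
  - by exists x; rewrite inE xA.
  - by rewrite inE h_sym => /andP[].
  rewrite !inE => /andP[zA zy] + yw; rewrite h_sym yw andbT => wA.
  have [vw|vw] := boolP (h v w); first exact: AA.
  by apply: contraTT yw => zw; apply: indep => //; exists z.
have AAi x y : x \in A -> y \in A -> ~~ h x y.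
  move=> xA yA; apply/negP => xy.
  have /negP[] : ~~ cocomponents x [set z in A | h x z].
    apply: smaller; first by apply/subsetP => z; rewrite inE => /andP[].
    by exists x; rewrite // inE xA /= h_cell.
  apply/cocomponentsP; split=> [|z|z w].
  - by exists y; rewrite inE yA.
  - by rewrite inE => /andP[].
  rewrite !inE => /andP[zA xz] + xw; rewrite xw andbT => wA.
  have [vw|vw] := boolP (h v w); first exact: AA.
  by apply: contraTT xw => zw; apply: AB => //; exists z.
exists a; split; first by exists v; rewrite h_sym Av.
have split_nonadj y : ~~ h a y -> (y \in A) || ~~ h v y.
  move=> ay; have [//|yA] := boolP (y \in A); apply: contra ay => vy; exact: AA.
move=> y z ay az.
have [yA|yA] := boolP (y \in A); have [zA|zA] := boolP (z \in A).
- exact: AAi.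
- apply: AB => //; last by exists a.
  by have := split_nonadj z az; rewrite (negbTE zA).
- rewrite h_sym; apply: AB => //; last by exists a.
  by have := split_nonadj y ay; rewrite (negbTE yA).
apply: indep; try by exists a.
  by have := split_nonadj y ay; rewrite (negbTE yA).
by have := split_nonadj z az; rewrite (negbTE zA).
Qed.

End Cosimplicial.

(** * Tilings by Stanley spaces *)

Section Tilings.
Variable n : nat.
Implicit Types (u m : 'X_{1..n}) (Z : {set 'I_n}) (P Q : 'X_{1..n} -> Prop).

Lemma stanley_monomialP u Z m :
  stanley_monomial u Z m <->
  (forall i, (u i <= m i) && ((i \in Z) || (m i == u i))).
Proof.
split=> [[v vZ ->] i|um].
  rewrite mnmDE leq_addr /=; case: (posnP (v i)) => [->|/vZ ->//].
  by rewrite addn0 eqxx orbT.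
exists (m - u)%MM => [i|].
  rewrite mnmBE subn_gt0 => lt_um; have /andP[_] := um i.
  by case/orP=> // /eqP mu; rewrite mu ltnn in lt_um.
apply/mnmP=> i; rewrite mnmDE mnmBE subnKC //; by have /andP[] := um i.
Qed.

(** A finite partition of [P] into Stanley spaces of dimension at least [d]. *)
Definition tiled (d : nat) P : Prop :=
  exists (J : finType) (u : J -> 'X_{1..n}) (Z : J -> {set 'I_n}),
    [/\ forall j, d <= #|Z j|,
        forall j m, stanley_monomial (u j) (Z j) m -> P m,
        forall m, P m -> exists j, stanley_monomial (u j) (Z j) m
      & forall j j' m, stanley_monomial (u j) (Z j) m ->
          stanley_monomial (u j') (Z j') m -> j = j'].

Lemma tiled_ext d P Q : (forall m, P m <-> Q m) -> tiled d P -> tiled d Q.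
Proof. by move=> PQ; rewrite (_ : Q = P) //; apply/funext => m; apply/propext; split=> /PQ. Qed.

Lemma tiled_empty d P : (forall m, ~ P m) -> tiled d P.
Proof.
move=> P0; exists 'I_0, (fun=> 0%MM), (fun=> set0).
by split=> [[]|[]|m /P0|[]].
Qed.

Lemma tiled_bigunion d (K : finType) (P : K -> 'X_{1..n} -> Prop) :
  (forall k, tiled d (P k)) ->
  (forall k k' m, P k m -> P k' m -> k = k') ->
  tiled d (fun m => exists k, P k m).
Proof.
move=> tP disj.
have /choice[D H] : forall k, exists D : {J : finType & J -> 'X_{1..n} * {set 'I_n}},
    let sm j m := stanley_monomial (projT2 D j).1 (projT2 D j).2 m in
    [/\ forall j, d <= #|(projT2 D j).2|, forall j m, sm j m -> P k m,
        forall m, P k m -> exists j, sm j m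
      & forall j j' m, sm j m -> sm j' m -> j = j'].
  move=> k; have [J [u [Z H]]] := tP k.
  by exists (existT _ J (fun j => (u j, Z j))).
pose J k := projT1 (D k); pose u k (j : J k) := (projT2 (D k) j).1.
pose Z k (j : J k) := (projT2 (D k) j).2.
exists {k : K & J k}, (fun j => u (tag j) (tagged j)), (fun j => Z (tag j) (tagged j)).
split=> [[k j]|[k j] m /=|m [k Pm]|[k j] [k' j'] m /= mj mj'].
- by case: (H k) => + _ _ _; apply.
- by case: (H k) => _ sub _ _ /sub; exists k.
- by case: (H k) => _ _ /(_ m Pm)[j mj] _; exists (Tagged J j).
have ekk : k = k'.
  apply: (disj _ _ m).
    by case: (H k) => _ sub _ _; apply: sub mj.
  by case: (H k') => _ sub _ _; apply: sub mj'.
case: k' / ekk j' mj' => j' mj'.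
by case: (H k) => _ _ _ /(_ j j' m mj mj') ->.
Qed.

Lemma tiled_union d P Q : tiled d P -> tiled d Q ->
  (forall m, P m -> Q m -> False) -> tiled d (fun m => P m \/ Q m).
Proof.
move=> tP tQ disj.
apply: (@tiled_ext _ (fun m => exists b : bool, if b then P m else Q m)).
  move=> m; split=> [[[]]|[]]; [by left|by right|by exists true|by exists false].
apply: (@tiled_bigunion d bool (fun b m => if b then P m else Q m)); first by case.
by move=> [] [] m // a b; case: (disj m).
Qed.

(** The free coordinates range over rays, whose starting points give the
    monomial [u]; the bounded ones are enumerated. *)
Lemma tiled_product (B : nat) Z (F : 'I_n -> nat -> Prop) :
  (forall k, k \in Z -> forall x y, x <= y -> F k x -> F k y) ->
  (forall k, k \notin Z -> forall x, F k x -> x < B) ->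
  tiled #|Z| (fun m => forall k, F k (m k)).
Proof.
move=> Fup Fbd.
have [[k kZ Fk]|Fne] := pselect (exists2 k, k \in Z & forall x, ~ F k x).
  by apply: tiled_empty => m /(_ k) /Fk.
have /choice[c cP] : forall k, exists c, k \in Z -> forall x, F k x <-> c <= x.
  move=> k; have [kZ|kZ] := boolP (k \in Z); last by exists 0.
  have [x Fx] : exists x, F k x.
    by apply: contrapT => Fk; apply: Fne; exists k => // x Fx; apply: Fk; exists x.
  have ex : exists x, `[< F k x >] by exists x; apply/asboolP.
  have [c /asboolP Fc cmin] := ex_minnP ex.
  exists c => _ y; split=> [/asboolP/cmin//|]; by move/Fup; apply.
pose good (g : {ffun 'I_n -> 'I_B.+1}) :=
  [forall k, if k \in Z then g k == ord0 else `[< F k (g k) >]].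
exists {g | good g},
  (fun g : {g | good g} => [multinom (if k \in Z then c k else val g k : nat) | k < n]),
  (fun=> Z).
split=> // [[g /= /forallP gP] m /stanley_monomialP mg k|m Fm|[g /= gP] [g' /= gP'] m].
- have /andP[] := mg k; rewrite mnmE; case: ifPn => kZ; first by move=> ? _; apply/cP.
  by move=> _ /eqP ->; have := gP k; rewrite (negbTE kZ) => /asboolP.
- pose g : {ffun 'I_n -> 'I_B.+1} := [ffun k => if k \in Z then ord0 else inord (m k)].
  have gm k : k \notin Z -> g k = m k :> nat.
    by move=> kZ; rewrite ffunE (negbTE kZ) inordK // ltnS ltnW // (Fbd k).
  have gP : good g.
    apply/forallP => k; case: ifPn => kZ; first by rewrite ffunE kZ.
    by apply/asboolP; rewrite gm.
  exists (Sub g gP); apply/stanley_monomialP => k /=; rewrite mnmE.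
  case: ifPn => kZ; first by rewrite andbT; apply/(cP k kZ).
  by rewrite gm // leqnn eqxx.
move=> /stanley_monomialP mg /stanley_monomialP mg'.
apply: val_inj; apply/ffunP => k /=; apply: val_inj => /=.
have [kZ|kZ] := boolP (k \in Z).
  move: gP gP' => /forallP/(_ k) + /forallP/(_ k); rewrite kZ.
  by move=> /eqP -> /eqP ->.
have /andP[_] := mg k; have /andP[_] := mg' k.
by rewrite !mnmE (negbTE kZ) /= => /eqP -> /eqP.
Qed.

Lemma tiledW d d' P : d <= d' -> tiled d' P -> tiled d P.
Proof.
move=> dd' [J [u [Z [c1 c2 c3 c4]]]]; exists J, u, Z; split=> // j.
exact: leq_trans (c1 j).
Qed.

End Tilings.

(** * Staircase graphs, and tilings in the chordal case *)

(** The common shape of the complements of the primary components: [E i j s t]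
    says that [x_i^s x_j^t] lies outside the component of [(x_i, x_j)]. *)
Record staircase_graph (n B : nat) (E : 'I_n -> 'I_n -> nat -> nat -> bool) : Prop := {
  staircase_irr : forall i s t, ~~ E i i s t;
  staircase_sym : forall i j s t, E i j s t = E j i t s;
  staircase_down : forall i j s t s' t', s' <= s -> t' <= t -> E i j s t -> E i j s' t';
  staircase_bound : forall i j s t, E i j s t -> s < B }.

Section Tile.
Variables (n B : nat) (E : 'I_n -> 'I_n -> nat -> nat -> bool).
Hypothesis EB : staircase_graph B E.
Implicit Types (m a : 'X_{1..n}).

Definition edge m i j := E i j (m i) (m j).
Definition alive m := exists i j, edge m i j.

Definition edge_no2K2 := forall m p q r s, edge m p q -> edge m r s ->
  ~~ edge m p r -> ~~ edge m p s -> ~~ edge m q r -> ~~ edge m q s -> False.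
Definition edge_noC5 := forall m p q r s t,
  edge m p q -> edge m q r -> edge m r s -> edge m s t -> edge m t p ->
  ~~ edge m p r -> ~~ edge m p s -> ~~ edge m q s -> ~~ edge m q t ->
  ~~ edge m r t -> False.

Lemma staircase_bound2 i j s t : E i j s t -> t < B.
Proof. by rewrite (staircase_sym EB) => /(staircase_bound EB). Qed.

(** The vertices are the pairs (variable, exponent), with the variables as
    cells; the exponents below [a] are cut off by isolating them.  A vertex of
    larger exponent has fewer neighbours, hence nested neighbourhoods. *)
Section Extremal.
Variable a : 'X_{1..n}.
Let T : finType := ('I_n * 'I_B)%type.
Definition vtx_adj (x y : T) :=
  [&& E x.1 y.1 x.2 y.2, a x.1 <= x.2 & a y.1 <= y.2].

Lemma vtx_adj_sym : symmetric vtx_adj.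
Proof. by move=> x y; rewrite /vtx_adj (staircase_sym EB) [X in _ && X]andbC. Qed.

Lemma vtx_adj_cell x y : x.1 = y.1 -> ~~ vtx_adj x y.
Proof. by rewrite /vtx_adj => ->; rewrite (negbTE (staircase_irr EB _ _ _)). Qed.

Lemma vtx_adj_nested x y : x.1 = y.1 ->
  (forall z, vtx_adj x z -> vtx_adj y z) \/ (forall z, vtx_adj y z -> vtx_adj x z).
Proof.
wlog le_xy : x y / x.2 <= y.2.
  move=> W xy; case/orP: (leq_total x.2 y.2) => le; first exact: W.
  by case: (W y x le (esym xy)); [right|left].
move=> xy; have [ax|ax] := leqP (a x.1) x.2; last first.
  by left=> z /and3P[_]; rewrite leqNgt ax.
right=> z /and3P[Eyz _ az]; apply/and3P; split=> //.
by rewrite xy; apply: (staircase_down EB le_xy (leqnn _)).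
Qed.

Lemma vtx_multinom (s : seq T) : uniq [seq x.1 | x <- s] ->
  exists m, forall x, x \in s -> m x.1 = x.2.
Proof.
elim: s => [|x s IH]; first by exists 0%MM.
rewrite map_cons cons_uniq => /andP[xs /IH[m mP]].
exists [multinom (if k == x.1 then x.2 : nat else m k) | k < n] => y.
rewrite mnmE inE => /orP[/eqP ->|ys]; first by rewrite eqxx.
rewrite ifN ?mP //; apply: contra xs => /eqP <-.
exact: map_f.
Qed.

Lemma vtx_adjN (x y : T) m : a x.1 <= x.2 -> a y.1 <= y.2 -> m x.1 = x.2 -> m y.1 = y.2 ->
  vtx_adj x y = edge m x.1 y.1.
Proof. by rewrite /vtx_adj /edge => -> -> -> ->; rewrite !andbT. Qed.

Lemma vtx_adj_le x y : vtx_adj x y -> a x.1 <= x.2.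
Proof. by case/and3P. Qed.

Lemma vtx_adj_neq x y : vtx_adj x y -> x.1 != y.1.
Proof. by move=> xy; apply/eqP => /vtx_adj_cell; rewrite xy. Qed.

Lemma vtx_no2K2 : edge_no2K2 -> forall p q r s, vtx_adj p q -> vtx_adj r s ->
  ~~ vtx_adj p r -> ~~ vtx_adj p s -> ~~ vtx_adj q r -> ~~ vtx_adj q s -> False.
Proof.
move=> no p q r s pq rs pr ps qr qs.
have sym x y : vtx_adj x y -> vtx_adj y x by rewrite vtx_adj_sym.
have symN x y : ~~ vtx_adj x y -> ~~ vtx_adj y x by rewrite vtx_adj_sym.
have ncell x y z w : vtx_adj x z -> ~~ vtx_adj y z -> vtx_adj y w -> ~~ vtx_adj x w ->
  x.1 != y.1 by move=> xz yz yw; apply: (diff_cell vtx_adj_nested xz yz yw).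
have [c1 c2] : p.1 != q.1 /\ r.1 != s.1 by split; apply: vtx_adj_neq.
have c3 : p.1 != r.1 by apply: (ncell p r q s); auto.
have c4 : p.1 != s.1 by apply: (ncell p s q r); auto.
have c5 : q.1 != r.1 by apply: (ncell q r p s); auto.
have c6 : q.1 != s.1 by apply: (ncell q s p r); auto.
have [|m mP] := @vtx_multinom [:: p; q; r; s].
  by rewrite /= !inE !negb_or c1 c2 c3 c4 c5 c6.
have [mp mq mr ms] : [/\ m p.1 = p.2, m q.1 = q.2, m r.1 = r.2 & m s.1 = s.2].
  by split; apply: mP; rewrite !inE eqxx ?orbT.
have [ap aq ar as_] : [/\ a p.1 <= p.2, a q.1 <= q.2, a r.1 <= r.2 & a s.1 <= s.2].
  by case/and3P: pq => _ -> ->; case/and3P: rs => _ -> ->.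
by apply: (no m p.1 q.1 r.1 s.1); rewrite -vtx_adjN.
Qed.

Lemma vtx_noC5 : edge_noC5 -> forall p q r s t,
  vtx_adj p q -> vtx_adj q r -> vtx_adj r s -> vtx_adj s t -> vtx_adj t p ->
  ~~ vtx_adj p r -> ~~ vtx_adj p s -> ~~ vtx_adj q s -> ~~ vtx_adj q t ->
  ~~ vtx_adj r t -> False.
Proof.
move=> no p q r s t pq qr rs st tp pr ps qs qt rt.
have sym x y : vtx_adj x y -> vtx_adj y x by rewrite vtx_adj_sym.
have symN x y : ~~ vtx_adj x y -> ~~ vtx_adj y x by rewrite vtx_adj_sym.
have ncell x y z w : vtx_adj x z -> ~~ vtx_adj y z -> vtx_adj y w -> ~~ vtx_adj x w ->
  x.1 != y.1 by move=> xz yz yw; apply: (diff_cell vtx_adj_nested xz yz yw).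
have c1 : p.1 != q.1 by apply: vtx_adj_neq.
have c2 : q.1 != r.1 by apply: vtx_adj_neq.
have c3 : r.1 != s.1 by apply: vtx_adj_neq.
have c4 : s.1 != t.1 by apply: vtx_adj_neq.
have c5 : p.1 != t.1 by apply: vtx_adj_neq; auto.
have c6 : p.1 != r.1 by apply: (ncell p r t s); auto.
have c7 : p.1 != s.1 by apply: (ncell p s q r); auto.
have c8 : q.1 != s.1 by apply: (ncell q s p t); auto.
have c9 : q.1 != t.1 by apply: (ncell q t r s); auto.
have c10 : r.1 != t.1 by apply: (ncell r t q p); auto.
have [|m mP] := @vtx_multinom [:: p; q; r; s; t].
  by rewrite /= !inE !negb_or c1 c2 c3 c4 c5 c6 c7 c8 c9 c10.
have [mp mq mr ms mt] : [/\ m p.1 = p.2, m q.1 = q.2, m r.1 = r.2, m s.1 = s.2 & m t.1 = t.2].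
  by split; apply: mP; rewrite !inE eqxx ?orbT.
have [ap aq ar as_ at_] : [/\ a p.1 <= p.2, a q.1 <= q.2, a r.1 <= r.2,
    a s.1 <= s.2 & a t.1 <= t.2].
  by case/and3P: pq => _ -> ->; case/and3P: rs => _ -> ->; case/and3P: tp => _ ->.
by apply: (no m p.1 q.1 r.1 s.1 t.1); rewrite -vtx_adjN.
Qed.
End Extremal.

Hypothesis hn : n <= 5.

Lemma card_setC2 (i j : 'I_n) : i != j -> #|~: [set i; j]| = n - 2.
Proof. by move=> ij; rewrite cardsCs setCK card_ord cards2 ij. Qed.

(** Let [i] be a cosimplicial variable at the corner [a].  For [m]
    above [a] with [m i = a i], the graph of [m] has an edge only if it has an
    edge at [i], and whether [i k] is an edge depends on [m k] alone.  So the monomials with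
    [m i = a i] split, by the first such [k], into products of rays in all
    coordinates but [i] and [k]; the others lie above the corner [a + U_(i)]. *)
Lemma tiled_cochordal : edge_no2K2 -> edge_noC5 -> tiled (n - 2) alive.
Proof.
move=> no2 no5.
suff H k a : \sum_i (B - a i) <= k -> tiled (n - 2) (fun m => (a <= m)%MM /\ alive m).
  apply: tiled_ext (H _ 0%MM (leqnn _)) => m; split=> [[]//|]; split=> //.
  by apply/mnm_lepP => i; rewrite mnm0E.
elim/ltn_ind: k a => k IH a ak.
have [some|none] := pselect (exists x y, vtx_adj a x y); last first.
  apply: tiled_empty => m [/mnm_lepP am [i [j ij]]]; apply: none.
  exists (i, Ordinal (staircase_bound EB ij)), (j, Ordinal (staircase_bound2 ij)).
  by rewrite /vtx_adj /= !am !andbT.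
have [[i s] [[y iy] cosimp]] := cosimplicial_vertex hn (@vtx_adj_sym a)
  (@vtx_adj_cell a) (@vtx_adj_nested a) (vtx_no2K2 no2) (vtx_noC5 no5) some.
have ais : a i <= s by have := vtx_adj_le iy.
have aiB : a i < B by apply: leq_ltn_trans ais _.
apply: (@tiled_ext _ _ (fun m =>
    ((a <= m)%MM /\ alive m) /\ m i = a i \/ ((a + U_(i))%MM <= m)%MM /\ alive m)).
  move=> m; split=> [[[]//|[am ?]]|[am ?]].
    by split=> //; apply: lepm_trans am; apply: lem_addr.
  have [mi|mi] := eqVneq (m i) (a i); [by left|right; split=> //].
  apply/mnm_lepP => j; rewrite mnmDE mnm1E; have/mnm_lepP/(_ j) := am.
  by have [<-|] := eqVneq i j; lia.
apply: tiled_union; last first.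
- by move=> m [_ mi] [/mnm_lepP/(_ i)]; rewrite mnmDE mnm1E eqxx mi; lia.
- have lt : \sum_j (B - (a + U_(i))%MM j) < k.
    apply: leq_trans ak; rewrite (bigD1 i) //= [X in _ < X](bigD1 i) //=.
    rewrite mnmDE mnm1E eqxx (eq_bigr (fun j => B - a j)); first by lia.
    by move=> j ji; rewrite mnmDE mnm1E eq_sym (negbTE ji) addn0.
  exact: (IH _ lt _ (leqnn _)).
pose P (c : 'I_n) m := [/\ (a <= m)%MM, m i = a i, edge m i c
   & forall l : 'I_n, l < c -> ~~ edge m i l].
apply: (@tiled_ext _ _ (fun m => exists c, P c m)).
  move=> m; split=> [[c [am mi ic _]]|[[am [j [l jl]]] mi]].
    by do 2!split=> //; exists i, c.
  have [c ic] : exists c, edge m i c.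
    have H z (zB : m z < B) : vtx_adj a (i, s) (z, Ordinal zB) -> edge m i z.
      case/and3P => /= + _ _; rewrite /edge mi; exact: (staircase_down EB).
    apply: contrapT => noc.
    have Nj : ~~ vtx_adj a (i, s) (j, Ordinal (staircase_bound EB jl)).
      by apply/negP => /H ij; apply: noc; exists j.
    have Nl : ~~ vtx_adj a (i, s) (l, Ordinal (staircase_bound2 jl)).
      by apply/negP => /H il; apply: noc; exists l.
    by have := cosimp _ _ Nj Nl; rewrite /vtx_adj /= !(mnm_lepP am) !andbT => /negP.
  have [c' c'P c'min] := arg_minnP (fun c : 'I_n => val c) ic.
  exists c'; split=> // l'; apply: contraTN => /c'min /=; by rewrite -leqNgt.
apply: tiled_bigunion => [c|c c' m [_ _ ic cmin] [_ _ ic' c'min]]; last first.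
  have [/c'min|/cmin|/ord_inj //] := ltngtP c c'.
    by rewrite ic.
  by rewrite ic'.
have [<-|ic] := eqVneq i c.
  by apply: tiled_empty => m [_ _]; rewrite /edge (negbTE (staircase_irr EB _ _ _)).
pose F (l : 'I_n) (x : nat) := [/\ a l <= x, l = i -> x = a i,
   l = c -> E i c (a i) x & l < c -> ~~ E i l (a i) x].
rewrite -(card_setC2 ic).
apply: tiled_ext (@tiled_product n B (~: [set i; c]) F _ _).
- move=> m; split=> [Fm|[am mi ic' cmin] l].
    have mi : m i = a i by case: (Fm i) => _ /(_ erefl).
    split=> //; first by apply/mnm_lepP => l; case: (Fm l).
      by case: (Fm c) => _ _ /(_ erefl) ? _; rewrite /edge mi.
    by move=> l lc; case: (Fm l) => _ _ _ /(_ lc); rewrite /edge mi.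
  split=> [|->//|->|/cmin]; first exact: (mnm_lepP am).
    by rewrite -mi.
  by rewrite /edge mi.
- move=> l; rewrite !inE negb_or => /andP[/eqP li /eqP lc] x x' xx' [H1 H2 H3 H4].
  split=> //; first exact: leq_trans xx'.
  by move=> /H4; apply: contra; apply: (staircase_down EB).
- move=> l; rewrite !inE negbK => /orP[/eqP ->|/eqP ->] x [_ H2 H3 _].
    by rewrite H2.
  exact: staircase_bound2 (H3 erefl).
Qed.
End Tile.

(** * Tilings of products of up-sets *)

Section Upsets.
Variables (n B : nat).
Definition upset1 (F : nat -> bool) := forall x y, x <= y -> F x -> F y.
Definition upset2 (A : nat -> nat -> bool) :=
  forall x y x' y', x <= x' -> y <= y' -> A x y -> A x' y'.
Definition full1 (F : nat -> bool) := forall x, B <= x -> F x.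
Definition full2 (A : nat -> nat -> bool) := forall x y, B <= x \/ B <= y -> A x y.

(** Cutting along the column of [m l], while it is bounded, leaves a ray in the
    coordinate [k]; the remaining columns are full. *)
Lemma tiled_upset2 (G : 'I_n -> nat -> Prop) (k l : 'I_n) (Fk Fl : nat -> bool) A :
  k != l -> (forall c, c != k -> c != l -> forall x, G c x -> x < B) ->
  upset1 Fk -> upset1 Fl -> full1 Fk -> full1 Fl -> upset2 A -> full2 A ->
  tiled 1 (fun m : 'X_{1..n} => (forall c, c != k -> c != l -> G c (m c)) /\
    [/\ Fk (m k), Fl (m l) & A (m k) (m l)]).
Proof.
move=> kl GB Fku Flu FkB FlB Au AB; have lk : l == k = false by rewrite eq_sym (negbTE kl).
pose P (t : 'I_B) (m : 'X_{1..n}) := m l = t /\ ((forall c, c != k -> c != l -> G c (m c)) /\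
    [/\ Fk (m k), Fl (m l) & A (m k) (m l)]).
pose Q (m : 'X_{1..n}) := B <= m l /\ ((forall c, c != k -> c != l -> G c (m c)) /\
    [/\ Fk (m k), Fl (m l) & A (m k) (m l)]).
apply: (@tiled_ext _ _ (fun m => (exists t, P t m) \/ Q m)).
  move=> m; split=> [[[t []]|[]]//|Hm].
  have [lt|le] := ltnP (m l) B; last by right.
  by left; exists (Ordinal lt).
apply: tiled_union; last first.
- by move=> m [t [mt _]] [le _]; have := ltn_ord t; rewrite -mt ltnNge le.
- apply: (@tiledW _ _ #|[set k; l]|); first by rewrite cards2; case: (_ != _).
  pose F c x := if c == k then Fk x else if c == l then B <= x else `[< G c x >].
  apply: tiled_ext (@tiled_product n B _ F _ _).
  + move=> m; split=> [Fm|[le [Gm [H1 H2 H3]]] c]; last first.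
      rewrite /F; case: eqVneq => [->//|ck]; case: eqVneq => [->//|cl].
      by apply/asboolP; apply: Gm.
    have := Fm k; rewrite /F eqxx => Hk; have := Fm l; rewrite /F lk eqxx => Hl.
    split=> //; split=> [c ck cl|]; last by split; [|apply: FlB|apply: AB; right].
    by have := Fm c; rewrite /F (negbTE ck) (negbTE cl) => /asboolP.
  + move=> c; rewrite !inE /F => + x y xy.
    have [->|] := eqVneq c k; first by move=> _; apply: Fku.
    by move=> _ /= ->; move=> /leq_trans; apply.
  + move=> c; rewrite !inE negb_or /F => /andP[ck cl] x.
    by rewrite (negbTE ck) (negbTE cl) => /asboolP; apply: GB.
apply: tiled_bigunion => [t|t t' m [mt _] [mt' _]]; last by apply: ord_inj; rewrite -mt -mt'.
rewrite -[1](cards1 k).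
pose F c x := if c == k then Fk x && A x t else if c == l then (x == t) && Fl t else `[< G c x >].
apply: tiled_ext (@tiled_product n B _ F _ _).
+ move=> m; split=> [Fm|[le [Gm [H1 H2 H3]]] c]; last first.
    rewrite /F; case: eqVneq => [->|ck]; first by rewrite H1 -le.
    case: eqVneq => [->|cl]; first by rewrite -le eqxx.
    by apply/asboolP; apply: Gm.
  have := Fm k; rewrite /F eqxx => /andP[Hk Hk'].
  have := Fm l; rewrite /F lk eqxx => /andP[/eqP ml Hl].
  split=> //; split=> [c ck cl|]; last by rewrite ml.
  by have := Fm c; rewrite /F (negbTE ck) (negbTE cl) => /asboolP.
+ move=> c; rewrite !inE /F => /eqP-> x y xy; rewrite eqxx => /andP[H1 H2].
  by rewrite (Fku x) // (Au x t).
+ move=> c; rewrite !inE /F => ck x; rewrite (negbTE ck).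
  case: eqVneq => [_|cl]; first by move=> /andP[/eqP -> _].
  by move=> /asboolP; apply: GB.
Qed.

(** For fixed values [y] and [z] of the coordinates [l] and [r], the values
    allowed at [k] form a ray, and its starting point is the larger of one bound
    that depends on [y] and one, [ga z], that depends on [z].  Where the bound by
    [z] wins, fixing [z] leaves rays in [k] and [l]; where the bound by [y] wins,
    fixing [y] leaves rays in [k] and [r].  So two coordinates are always free. *)
Lemma tiled_upset3 (G : 'I_n -> nat -> Prop) (k l r : 'I_n) (Fk Fl Fr : nat -> bool) Akl Akr Alr :
  uniq [:: k; l; r] -> (forall c, c \notin [:: k; l; r] -> forall x, G c x -> x < B) ->
  upset1 Fk -> upset1 Fl -> upset1 Fr -> full1 Fk -> full1 Fl -> full1 Fr ->
  upset2 Akl -> upset2 Akr -> upset2 Alr -> full2 Akl -> full2 Akr -> full2 Alr ->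
  tiled 2 (fun m : 'X_{1..n} => (forall c, c \notin [:: k; l; r] -> G c (m c)) /\
    ([/\ Fk (m k), Fl (m l) & Fr (m r)] /\
    [/\ Akl (m k) (m l), Akr (m k) (m r) & Alr (m l) (m r)])).
Proof.
move=> u GB Fku Flu Fru FkB FlB FrB Aklu Akru Alru AklB AkrB AlrB.
move: (u) => /=; rewrite !inE negb_or andbT => /andP[/andP[kl kr] lr].
have [lk [rk rl]] : l != k /\ r != k /\ r != l by rewrite ![_ == k]eq_sym [r == l]eq_sym kl kr lr.
have /choice[ga gaP] : forall z, exists g, forall x, (g <= x) = Fk x && Akr x z.
  move=> z; have ex : exists x, Fk x && Akr x z.
    by exists B; rewrite FkB // AkrB //; left.
  have [g /andP[g1 g2] gmin] := ex_minnP ex; exists g => x.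
  apply/idP/idP => [gx|/gmin//]; by rewrite (Fku g) // (Akru g z).
have ga_anti z z' : z <= z' -> ga z' <= ga z.
  move=> zz'; rewrite gaP; have := leqnn (ga z); rewrite gaP => /andP[-> H].
  exact: Akru H.
pose W (m : 'X_{1..n}) := (forall c, c \notin [:: k; l; r] -> G c (m c)) /\
    ([/\ Fk (m k), Fl (m l) & Fr (m r)] /\
    [/\ Akl (m k) (m l), Akr (m k) (m r) & Alr (m l) (m r)]).
(* [R m] says that the bound coming from the coordinate [r] wins. *)
pose R (m : 'X_{1..n}) := Akl (ga (m r)) (m l).
pose P1 (t : 'I_B) (m : 'X_{1..n}) := [/\ m r = t, R m & W m].
pose P2 (t : 'I_B) (m : 'X_{1..n}) := [/\ m l = t, ~~ R m & W m].
pose P3 (m : 'X_{1..n}) := [/\ B <= m r, R m & W m].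
apply: (@tiled_ext _ _ (fun m => (exists t, P1 t m) \/ (exists t, P2 t m) \/ P3 m)).
  move=> m; split=> [[[t []]//|[[t []]|[]]//]|Wm].
  have [Rm|Rm] := boolP (R m).
    have [lt|le] := ltnP (m r) B; last by right; right.
    by left; exists (Ordinal lt).
  have lt : m l < B.
    by rewrite ltnNge; apply: contra Rm => le; apply: AklB; right.
  by right; left; exists (Ordinal lt).
pose pick3 (x y z w : bool) c := if c == k then x else if c == l then y else if c == r then z else w.
have pickk x y z w : pick3 x y z w k = x by rewrite /pick3 eqxx.
have pickl x y z w : pick3 x y z w l = y by rewrite /pick3 (negbTE lk) eqxx.
have pickr x y z w : pick3 x y z w r = z by rewrite /pick3 (negbTE rk) (negbTE rl) eqxx.
have picko x y z w c : c \notin [:: k; l; r] -> pick3 x y z w c = w.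
  by rewrite !inE !negb_or /pick3 => /and3P[/negbTE-> /negbTE-> /negbTE->].
have pickP (X Y Z : nat -> bool) (m : 'X_{1..n}) :
   (forall c, pick3 (X (m c)) (Y (m c)) (Z (m c)) `[< G c (m c) >] c) <->
   [/\ X (m k), Y (m l), Z (m r) & forall c, c \notin [:: k; l; r] -> G c (m c)].
  split=> [H|[Hx Hy Hz Ho] c].
    have := H k; have := H l; have := H r; rewrite pickk pickl pickr => -> -> ->; split=> // c co.
    by have := H c; rewrite picko // => /asboolP.
  rewrite /pick3; case: (eqVneq c k) => [->//|ck]; case: (eqVneq c l) => [->//|cl].
  case: (eqVneq c r) => [->//|cr]; apply/asboolP/Ho.
  by rewrite !inE !negb_or ck cl.
apply: tiled_union; last first.
- move=> m [t [mt Rm _]] [[t' [_ Rm' _]]|[le _ _]]; first by rewrite Rm in Rm'.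
  by have := ltn_ord t; rewrite -mt ltnNge le.
- apply: tiled_union; last by move=> m [t [_ Rm _]] [_ Rm' _]; rewrite Rm' in Rm.
    apply: tiled_bigunion => [t|t t' m [mt _ _] [mt' _ _]]; last by apply: ord_inj; rewrite -mt -mt'.
    apply: (@tiledW _ _ #|[set k; r]|); first by rewrite cards2 kr.
    pose F c x := pick3 (Fk x && Akl x t) ((x == t) && Fl t)
      [&& Fr x, Alr t x & ~~ Akl (ga x) t] `[< G c x >] c.
    apply: tiled_ext (@tiled_product n B _ F _ _).
    + move=> m; rewrite (pickP (fun x => Fk x && Akl x t) (fun x => (x == t) && Fl t)
        (fun x => [&& Fr x, Alr t x & ~~ Akl (ga x) t])).
      rewrite /P2 /R /W; split=> [[/andP[H1 H2] /andP[/eqP-> H3] /and3P[H4 H5 H6] H7]|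
        [-> H6 [H7 [[-> -> ->] [-> H2 ->]]]]]; last by rewrite eqxx H6.
      do 4![split=> //].
      have : ga (m r) <= m k.
        by rewrite leqNgt; apply: contra H6 => /ltnW le; apply: Aklu H2.
      by rewrite gaP => /andP[].
    + move=> c; rewrite !inE /F => /orP[]/eqP-> x y xy; rewrite ?pickk ?pickr.
        by move=> /andP[H1 H2]; rewrite (Fku x) // (Aklu x t).
      move=> /and3P[H1 H2 H3]; rewrite (Fru x) // (Alru t x) //=.
      by apply: contra H3; apply: Aklu => //; apply: ga_anti.
    + move=> c; rewrite !inE negb_or /F => /andP[ck cr] x.
      have [->|cl] := eqVneq c l; first by rewrite pickl => /andP[/eqP -> _].
      have co : c \notin [:: k; l; r] by rewrite !inE !negb_or ck cl.
      by rewrite picko // => /asboolP; apply: GB.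
  apply: (@tiledW _ _ #|[set k; l; r]|).
    by rewrite -setUA cardsU1 cards2 !inE negb_or kl kr lr.
  pose F c x := pick3 (Fk x) (Fl x && Akl (ga B) x) (B <= x) `[< G c x >] c.
  have gaB z : B <= z -> ga z = ga B.
    move=> Bz; apply/eqP; rewrite eqn_leq ga_anti //= gaP AkrB ?andbT; last by right.
    by have := leqnn (ga z); rewrite gaP => /andP[].
  apply: tiled_ext (@tiled_product n B _ F _ _).
  + move=> m; rewrite (pickP Fk (fun x => Fl x && Akl (ga B) x) (fun x => B <= x)).
    rewrite /P3 /R /W; split=> [[H1 /andP[H2 H3] H4 H5]|[H4 H3 [H5 [[-> -> _] [_ _ _]]]]].
      rewrite gaB // H3 H1 H2 FrB // AkrB ?AlrB; [|by right..].
      split=> //; do 2![split=> //]; split=> //.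
      apply: Aklu H3 => //; rewrite gaP H1 AkrB //; by right.
    by rewrite -(gaB _ H4) H3.
  + move=> c; rewrite !inE /F -orbA => /or3P[]/eqP-> x y xy; rewrite ?pickk ?pickl ?pickr.
    * exact: Fku.
    * by move=> /andP[H1 H2]; rewrite (Flu x) // (Aklu (ga B) x).
    * by move=> /leq_trans; apply.
  + move=> c co x; have {}co : c \notin [:: k; l; r] by move: co; rewrite !inE orbA.
    by rewrite /F picko // => /asboolP; apply: GB.
apply: tiled_bigunion => [t|t t' m [mt _ _] [mt' _ _]]; last by apply: ord_inj; rewrite -mt -mt'.
apply: (@tiledW _ _ #|[set k; l]|); first by rewrite cards2 kl.
pose F c x := pick3 (Fk x && Akr x t) [&& Fl x, Alr x t & Akl (ga t) x]
  ((x == t) && Fr t) `[< G c x >] c.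
apply: tiled_ext (@tiled_product n B _ F _ _).
+ move=> m; rewrite (pickP (fun x => Fk x && Akr x t)
    (fun x => [&& Fl x, Alr x t & Akl (ga t) x]) (fun x => (x == t) && Fr t)).
  rewrite /P1 /R /W; split=> [[/andP[H1 H2] /and3P[H4 H5 H6] /andP[/eqP-> H3] H7]|
    [-> H6 [H7 [[-> -> ->] [_ -> ->]]]]]; last by rewrite eqxx H6.
  do 4![split=> //].
  by apply: Aklu H6 => //; rewrite gaP H1.
+ move=> c; rewrite !inE /F => /orP[]/eqP-> x y xy; rewrite ?pickk ?pickl.
    by move=> /andP[H1 H2]; rewrite (Fku x) // (Akru x t).
  move=> /and3P[H1 H2 H3]; rewrite (Flu x) // (Alru x t) //=.
  by apply: Aklu H3.
+ move=> c; rewrite !inE negb_or /F => /andP[ck cl] x.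
  have [->|cr] := eqVneq c r; first by rewrite pickr => /andP[/eqP -> _].
  have co : c \notin [:: k; l; r] by rewrite !inE !negb_or ck cl.
  by rewrite picko // => /asboolP; apply: GB.
Qed.
End Upsets.

(** * Tilings by the first edge *)

Section FirstEdge.
Variables (n B : nat) (E : 'I_n -> 'I_n -> nat -> nat -> bool).
Hypothesis EB : staircase_graph B E.

(** Fix the first edge [i j] of the graph of [m] and the exponents of [x_i] and
    [x_j].  Each earlier pair imposes that some pair of exponents lie above a
    staircase: a ray condition if the pair meets [i j], and a condition on two of
    the [n - 2] remaining coordinates otherwise. *)
Lemma tiled_first_edge : n = 4 \/ n = 5 -> tiled (n - 3) (alive E).
Proof.
move=> n45.
pose before (e' e : 'I_n * 'I_n) := enum_rank e' < enum_rank e.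
pose first (e : 'I_n * 'I_n) (m : 'X_{1..n}) :=
  edge E m e.1 e.2 /\ forall e', before e' e -> ~~ edge E m e'.1 e'.2.
pose P (c : ('I_n * 'I_n) * ('I_B * 'I_B)) (m : 'X_{1..n}) :=
  [/\ m c.1.1 = c.2.1, m c.1.2 = c.2.2 & first c.1 m].
apply: (@tiled_ext _ _ (fun m => exists c, P c m)).
  move=> m; split=> [[[[i j] [p q]] [_ _ [ij _]]]|[i [j ij]]]; first by exists i, j.
  have [e eP emin] := arg_minnP (fun e : 'I_n * 'I_n => val (enum_rank e)) (ij : (fun e : 'I_n * 'I_n => edge E m e.1 e.2) (i, j)).
  exists (e, (Ordinal (staircase_bound EB eP), Ordinal (staircase_bound2 EB eP))).
  split=> //; split=> // e'; apply: contraTN => /emin /=.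
  by rewrite /before -leqNgt.
apply: tiled_bigunion => [|[e [p q]] [e' [p' q']] m [/= m1 m2 [H1 H2]] [/= m1' m2' [H1' H2']]]; last first.
  have ee : e = e'.
    have [/H2'|/H2|/ord_inj/enum_rank_inj //] := ltngtP (enum_rank e) (enum_rank e').
      by rewrite H1.
    by rewrite H1'.
  rewrite -ee in m1' m2' *; congr (_, (_, _)); apply: ord_inj; congruence.
move=> [[i j] [p q]].
pose prior c d := before (c, d) (i, j) || before (d, c) (i, j).
pose ok (m : 'X_{1..n}) c d := ~~ (prior c d && edge E m c d).
have prior_sym c d : prior c d = prior d c by rewrite /prior orbC.
have ok_sym m : symmetric (ok m).
  by move=> c d; rewrite /ok prior_sym /edge (staircase_sym EB).
have ok_refl m : reflexive (ok m).
  by move=> c; rewrite /ok /edge (negbTE (staircase_irr EB _ _ _)) andbF.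
have PE m : P (i, j, (p, q)) m <->
    [/\ m i = p, m j = q, E i j p q & forall c d, ok m c d].
  split=> [[/= mi mj [ij H]]|[mi mj ij H]].
    split=> // [|c d]; first by move: ij; rewrite /edge /= mi mj.
    rewrite /ok negb_and -implybE; apply/implyP => /orP[/H//|/H].
    by rewrite /edge (staircase_sym EB).
  split=> //; split; rewrite /= ?/edge /= ?mi ?mj // => -[c d] cd.
  by have := H c d; rewrite /ok /prior cd.
have [/andP[Eij Nprior]|const] := boolP (E i j p q && ~~ prior i j); last first.
  apply: tiled_empty => m /PE [mi mj ij /(_ i j)]; move: const.
  by rewrite /ok /edge mi mj ij andbT /= => /negP.
have ij : i != j by apply: contraTneq Eij => ->; exact: (staircase_irr EB).
pose s := enum (~: [set i; j]).
have ssize : size s = n - 2 by rewrite /s -cardE card_setC2.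
have smem c : (c \in s) = (c != i) && (c != j).
  by rewrite mem_enum !inE negb_or.
have s_all c : c \in [:: i, j & s].
  by rewrite !inE smem; case: (c == i); case: (c == j).
have su : uniq s := enum_uniq _.
have PE' m : P (i, j, (p, q)) m <->
    [/\ m i = p, m j = q & pairwise (ok m) [:: i, j & s]].
  rewrite PE pairwise_all2rel //; split=> [[mi mj _ H]|[mi mj /allrelP H]].
    by split=> //; apply/allrelP.
  by split=> // c d; apply: H.
pose G (c : 'I_n) (x : nat) := (c = i -> x = p) /\ (c = j -> x = q).
have Gbd c x : (c == i) || (c == j) -> G c x -> x < B.
  by case/orP=> /eqP-> [H1 H2]; [rewrite H1|rewrite H2].
pose F c x := ~~ (prior i c && E i c p x) && ~~ (prior j c && E j c q x).
have Fup c : upset1 (F c).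
  move=> x y xy /andP[H1 H2]; apply/andP; split.
    by apply: contra H1 => /andP[-> /(staircase_down EB (leqnn _) xy)].
  by apply: contra H2 => /andP[-> /(staircase_down EB (leqnn _) xy)].
have Ffull c : full1 B (F c).
  move=> x Bx; apply/andP; split; apply/negP => /andP[_ /(staircase_bound2 EB)];
  by rewrite ltnNge Bx.
pose A c d x y := ~~ (prior c d && E c d x y).
have Aup c d : upset2 (A c d).
  move=> x y x' y' xx yy; apply: contra => /andP[-> ].
  exact: (staircase_down EB).
have Afull c d : full2 B (A c d).
  move=> x y [Bx|By]; apply/negP => /andP[_ H].
    by have := staircase_bound EB H; rewrite ltnNge Bx.
  by have := staircase_bound2 EB H; rewrite ltnNge By.
have okij (m : 'X_{1..n}) : m i = p -> m j = q -> ok m i j by move=> ? ?; rewrite /ok negb_and Nprior.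
have Fok (m : 'X_{1..n}) c : m i = p -> m j = q -> F c (m c) = ok m i c && ok m j c.
  by move=> mi mj; rewrite /F /ok /edge mi mj.
have out (m : 'X_{1..n}) : (forall c, c \notin s -> G c (m c)) <-> m i = p /\ m j = q.
  split=> [H|[mi mj] c]; last by move=> _; split=> ->.
  by split; [case: (H i)|case: (H j)] => //; rewrite ?smem ?eqxx ?andbF // => H1 H2; [apply: H1|apply: H2].
have [[n3 s2]|[n3 s3]] : (n - 3 = 1 /\ size s = 2) \/ (n - 3 = 2 /\ size s = 3).
  by rewrite ssize; lia.
  rewrite n3; case: s {ssize} s2 smem s_all su PE' out => [//|k [//|l [|//]]] _ smem s_all su PE' out.
  have kl : k != l by move: su; rewrite /= inE andbT.
  have := @tiled_upset2 n B G k l (F k) (F l) (A k l) kl.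
  move=> /(_ _ (Fup k) (Fup l) (Ffull k) (Ffull l) (Aup k l) (Afull k l)) T.
  apply: tiled_ext (T _).
    move=> m; rewrite PE'; split=> [[H1 [H2 H3 H4]]|[mi mj]].
      have [mi mj] : m i = p /\ m j = q.
        by apply/out => c; rewrite !inE negb_or => /andP[]; apply: H1.
      split=> //=; rewrite !andbT okij //.
      move: H2 H3; rewrite !Fok // => /andP[-> ->] /andP[-> ->]; exact: H4.
    rewrite /= !andbT => /and3P[/and3P[_ ik il] /andP[jk jl] kl'].
    split; last by rewrite !Fok // ik il jk jl.
    by move=> c ck cl; move: (conj mi mj) => /out; apply; rewrite !inE negb_or ck.
  move=> c ck cl x; apply: Gbd; have := smem c; rewrite !inE (negbTE ck) (negbTE cl).
  by move/esym/negbT; rewrite negb_and !negbK.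
rewrite n3; case: s {ssize} s3 smem s_all su PE' out => [//|k [//|l [//|r [|//]]]] _ smem s_all su PE' out.
have := @tiled_upset3 n B G k l r (F k) (F l) (F r) (A k l) (A k r) (A l r) su.
move=> /(_ _ (Fup k) (Fup l) (Fup r) (Ffull k) (Ffull l) (Ffull r) (Aup k l) (Aup k r) (Aup l r)
  (Afull k l) (Afull k r) (Afull l r)) T.
apply: tiled_ext (T _).
  move=> m; rewrite PE'; split=> [[H1 [[H2 H3 H4] [H5 H6 H7]]]|[mi mj]].
    have [mi mj] : m i = p /\ m j = q by apply/out.
    split=> //=; rewrite !andbT okij //.
    move: H2 H3 H4; rewrite !Fok // => /andP[-> ->] /andP[-> ->] /andP[-> ->].
    by apply/and4P; split=> //; apply/andP.
  rewrite /= !andbT => /and4P[/and4P[_ ik il ir] /and3P[jk jl jr] /andP[kl' kr'] lr'].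
  split; last by rewrite !Fok // ik il ir jk jl jr.
  by apply/out.
move=> c co x; apply: Gbd; have := smem c; rewrite (negbTE co).
by move/esym/negbT; rewrite negb_and !negbK.
Qed.
End FirstEdge.

(** * Koszul cohomology and regular sequences *)

Local Open Scope ring_scope.

Section IdealFacts.
Variable R : comNzRingType.
Implicit Types (I J : R -> Prop).

Lemma ideal0 J : is_ideal J -> J 0. Proof. by case. Qed.
Lemma idealD J f g : is_ideal J -> J f -> J g -> J (f + g). Proof. by case=> _ H _; apply: H. Qed.
Lemma idealM J c f : is_ideal J -> J f -> J (c * f). Proof. by case=> _ _; apply. Qed.
Lemma idealN J f : is_ideal J -> J f -> J (- f).
Proof. by move=> Ji Jf; rewrite -mulN1r; apply: idealM. Qed.
Lemma idealB J f g : is_ideal J -> J f -> J g -> J (f - g).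
Proof. by move=> Ji Jf Jg; apply: idealD => //; apply: idealN. Qed.
Lemma ideal_sum (X : Type) (r : seq X) (P : pred X) (F : X -> R) J : is_ideal J ->
  (forall i, P i -> J (F i)) -> J (\sum_(i <- r | P i) F i).
Proof.
move=> Ji JF; elim/big_ind: _ => //; first exact: ideal0.
by move=> *; apply: idealD.
Qed.

Lemma ideal_gen_ideal (A : R -> Prop) : is_ideal (ideal_gen A).
Proof.
split=> [|f g [s sA ->] [t tA ->]|c f [s sA ->]].
- by exists [::]; rewrite ?big_nil.
- exists (s ++ t); last by rewrite big_cat.
  by move=> p; rewrite mem_cat => /orP[/sA|/tA].
exists [seq (c * p.1, p.2) | p <- s].
  by move=> p /mapP[q qs ->] /=; exact: sA.
by rewrite big_map mulr_sumr; apply: eq_bigr => p _; rewrite mulrA.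
Qed.

Lemma ideal_gen_incl (A : R -> Prop) f : A f -> ideal_gen A f.
Proof.
by exists [:: (1, f)]; [move=> p; rewrite inE => /eqP->|rewrite big_seq1 mul1r].
Qed.

Lemma ideal_gen_min (A J : R -> Prop) f : is_ideal J -> (forall g, A g -> J g) ->
  ideal_gen A f -> J f.
Proof.
move=> Ji AJ [s sA ->]; rewrite big_seq; apply: ideal_sum => // p /sA /AJ.
exact: idealM.
Qed.

Lemma ideal_add_prefix0 I fs f : is_ideal I -> ideal_add_prefix I fs 0 f <-> I f.
Proof.
move=> Ii; split; last by move=> If; apply: ideal_gen_incl; left.
by apply: ideal_gen_min => // g []; rewrite // take0.
Qed.

Lemma ideal_add_prefixS I fs i f : (i < size fs)%N ->
  ideal_add_prefix I fs i.+1 f <-> exists r, ideal_add_prefix I fs i (f - r * fs`_i).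
Proof.
move=> ifs.
have Ji : is_ideal (ideal_add_prefix I fs i) by exact: ideal_gen_ideal.
rewrite {1}/ideal_add_prefix (take_nth 0 ifs); split=> [|[r]].
  apply: (@ideal_gen_min _ (fun h => exists r, ideal_add_prefix I fs i (h - r * fs`_i))) => [|g]; last first.
    rewrite mem_rcons inE => -[Ig|/orP[/eqP->|gi]].
    - by exists 0; rewrite mul0r subr0; apply: ideal_gen_incl; left.
    - by exists 1; rewrite mul1r subrr; apply: ideal0.
    - by exists 0; rewrite mul0r subr0; apply: ideal_gen_incl; right.
  split=> [|g h [r Jg] [s Jh]|c g [r Jg]].
  - by exists 0; rewrite mul0r subr0; apply: ideal0.
  - exists (r + s); rewrite mulrDl opprD addrACA; exact: idealD.
  - by exists (c * r); rewrite -mulrA -mulrBr; apply: idealM.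
move=> Jf; rewrite -[f](subrK (r * fs`_i)).
have Ji' := ideal_gen_ideal (fun g => I g \/ g \in rcons (take i fs) fs`_i).
apply: idealD => //.
  apply: ideal_gen_min Jf => // g [Ig|gi]; apply: ideal_gen_incl; first by left.
  by right; rewrite mem_rcons inE gi orbT.
apply: idealM => //; apply: ideal_gen_incl; right.
by rewrite mem_rcons inE eqxx.
Qed.
End IdealFacts.

Section Koszul.
Variables (R : comNzRingType) (T : finType).
Implicit Types (g h c : T -> R) (y z : seq T -> R) (s t : seq T) (J : R -> Prop).

(** Left multiplication by the linear form [\sum_i g i * e_i] on cochains, which
    is the Koszul differential of the family [g].  Cochains are functions on
    sequences, not required to be alternating, so that no sign of a permutation
    ever appears. *)
Fixpoint wedge g z s : R :=
  if s is i :: s' then g i * z s' - wedge g (fun t => z (i :: t)) s' else 0.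

Definition contr c z s : R := \sum_i c i * z (i :: s).

Lemma eq_wedge g z z' s : z =1 z' -> wedge g z s = wedge g z' s.
Proof.
elim: s z z' => //= i s IH z z' zz'; rewrite zz'; congr (_ - _).
by apply: IH => t; apply: zz'.
Qed.

Lemma eq_wedgel g g' z s : g =1 g' -> wedge g z s = wedge g' z s.
Proof. by move=> gg'; elim: s z => //= i s IH z; rewrite gg' IH. Qed.

Lemma wedge_ideal g z s J : is_ideal J ->
  (forall t, (size t).+1 = size s -> J (z t)) -> J (wedge g z s).
Proof.
move=> Ji; elim: s z => /= [|i s IH] z Jz; first exact: ideal0.
apply: idealB => //; first by apply: idealM => //; apply: Jz.
by apply: IH => t ts; apply: Jz; rewrite /= ts.
Qed.

Lemma wedgeB g z y s : wedge g (fun t => z t - y t) s = wedge g z s - wedge g y s.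
Proof.
elim: s z y => /= [|i s IH] z y; first by rewrite subr0.
rewrite IH; ring.
Qed.

Lemma wedgeZ g a z s : wedge g (fun t => a * z t) s = a * wedge g z s.
Proof.
elim: s z => /= [|i s IH] z; first by rewrite mulr0.
rewrite IH; ring.
Qed.

Lemma wedge_sum (X : Type) (r : seq X) g (z : X -> seq T -> R) s :
  wedge g (fun t => \sum_(x <- r) z x t) s = \sum_(x <- r) wedge g (z x) s.
Proof.
elim: s z => /= [|i s IH] z; first by rewrite big1.
by rewrite IH mulr_sumr -sumrB.
Qed.

Lemma wedgeDl g h a z s :
  wedge (fun i => g i + a * h i) z s = wedge g z s + a * wedge h z s.
Proof.
elim: s z => /= [|i s IH] z; first by rewrite mulr0 addr0.
rewrite IH; ring.
Qed.

Lemma wedge_anti g h z s : wedge g (wedge h z) s = - wedge h (wedge g z) s.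
Proof.
elim: s z => /= [|i s IH] z; first by rewrite oppr0.
rewrite !wedgeB !wedgeZ IH; ring.
Qed.

Lemma wedge_sq g z s : wedge g (wedge g z) s = 0.
Proof.
elim: s z => //= i s IH z.
rewrite wedgeB wedgeZ IH; ring.
Qed.

(** Contraction by [c] is a homotopy from multiplication by [\sum_i c i * g i]
    to zero. *)
Lemma wedge_contr g c z s :
  wedge g (contr c z) s = (\sum_i c i * g i) * z s - contr c (wedge g z) s.
Proof.
rewrite /contr mulr_suml -sumrB wedge_sum; apply: eq_bigr => i _ /=.
rewrite wedgeZ; ring.
Qed.

(** Vanishing of the Koszul cohomology of the quotient by [J] in degree [p]. *)
Definition koszul_exact g J (p : nat) : Prop :=
  forall z, (forall s, size s = p.+1 -> J (wedge g z s)) ->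
  exists y, forall s, size s = p -> J (z s - wedge g y s).

Definition in_radical g (f : R) : Prop := exists L c, f ^+ L = \sum_i c i * g i.

Lemma regular_expn J (f : R) L (a : R) : (forall h : R, J (f * h) -> J h) -> J (f ^+ L * a) -> J a.
Proof.
move=> reg; elim: L => [|L IH]; first by rewrite expr0 mul1r.
by rewrite exprS -mulrA => /reg.
Qed.

Lemma koszul_exact0 g J f : is_ideal J -> in_radical g f ->
  (forall h : R, J (f * h) -> J h) -> koszul_exact g J 0.
Proof.
move=> Ji [L [c fL]] reg z Jz; exists (fun=> 0) => s /size0nil-> /=; rewrite subr0.
apply: (regular_expn (L := L) reg); rewrite fL mulr_suml.
apply: ideal_sum => // i _; rewrite -mulrA; apply: idealM => //.
by have := Jz [:: i] erefl; rewrite /= subr0.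
Qed.

(** By the long exact sequence of multiplication by [f], vanishing for the
    quotient by [J' = J + (f)] in degree [p] makes [f] injective on the
    cohomology for [J] in degree [p.+1]; but a power of [f] annihilates it. *)
Lemma koszul_exactS g J J' f p : is_ideal J -> in_radical g f ->
  (forall h : R, J (f * h) -> J h) -> (forall h : R, J' h <-> exists r, J (h - r * f)) ->
  koszul_exact g J' p -> koszul_exact g J p.+1.
Proof.
move=> Ji [L [c fL]] reg J'E exJ'.
pose cob z := exists y, forall s, size s = p.+1 -> J (z s - wedge g y s).
have divf z : cob (fun s => f * z s) -> cob z.
  move=> [u uP].
  have [s ps|y yP] := exJ' u.
    apply/J'E; exists (z s); have /(idealN Ji) := uP s ps.
    by rewrite opprB [f * _]mulrC.
  have /choice[r rP] : forall s, exists r, size s = p -> J (u s - wedge g y s - r * f).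
    move=> s; have [ps|ps] := eqVneq (size s) p; last by exists 0 => /eqP; rewrite (negbTE ps).
    by have /J'E[r] := yP s ps; exists r.
  exists r => s ps; apply: reg.
  have : J (wedge g (fun t => u t - wedge g y t - r t * f) s).
    by apply: wedge_ideal => // t; rewrite ps => -[ts]; apply: rP.
  rewrite wedgeB wedgeB wedge_sq subr0.
  rewrite (@eq_wedge g (fun t => r t * f) (fun t => f * r t)) => [|t]; last by rewrite mulrC.
  rewrite wedgeZ => H; have := idealD Ji (uP s ps) H.
  congr (J _); ring.
have divfn k z : cob (fun s => f ^+ k * z s) -> cob z.
  elim: k z => [|k IH] z [y yP].
    by exists y => s /yP; rewrite expr0 mul1r.
  apply/IH/divf; exists y => s /yP; by rewrite exprS mulrA.
move=> z Jz; apply: (divfn L); exists (contr c z) => s ps.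
rewrite wedge_contr -fL opprB addrC subrK.
by apply: ideal_sum => // i _; apply: idealM => //; apply: Jz; rewrite /= ps.
Qed.

Lemma regular_sequence_koszul g I fs p : is_ideal I ->
  (forall f, f \in fs -> in_radical g f) -> regular_sequence I fs ->
  (p < size fs)%N -> koszul_exact g I p.
Proof.
move=> Ii rad [reg _] pfs.
suff H i : (i + p < size fs)%N -> koszul_exact g (ideal_add_prefix I fs i) p.
  move=> z Jz; have [|s sp|y yP] := H 0 _ z; first by rewrite add0n.
    by apply/ideal_add_prefix0 => //; apply: Jz.
  by exists y => s /yP /(ideal_add_prefix0 _ _ Ii).
elim: p i {pfs} => [|p IH] i lt.
  rewrite addn0 in lt; apply: (@koszul_exact0 g _ fs`_i); first exact: ideal_gen_ideal.
    by apply: rad; rewrite mem_nth.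
  exact: reg.
have lti : (i < size fs)%N by apply: leq_ltn_trans lt; rewrite leq_addr.
apply: (@koszul_exactS g _ (ideal_add_prefix I fs i.+1) fs`_i).
- exact: ideal_gen_ideal.
- by apply: rad; rewrite mem_nth.
- exact: reg.
- by move=> h; apply: ideal_add_prefixS.
- by apply: IH; rewrite addSnnS.
Qed.

(** Modulo the [g k] with [k] in [K], only the positions in [s] contribute. *)
Lemma wedge_cat g y K s J : is_ideal J -> (forall k, k \in K -> J (g k)) ->
  J (wedge g y (K ++ s) - (-1) ^+ size K * wedge g (fun t => y (K ++ t)) s).
Proof.
move=> Ji; elim: K y => [|k K IH] y JK; first by rewrite mul1r subrr; apply: ideal0.
rewrite /= exprS mulN1r mulNr opprK -addrA [- _ + _]addrC -opprB.
apply: idealB => //; last by apply: IH => i iK; apply: JK; rewrite inE iK orbT.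
by rewrite mulrC; apply: idealM => //; apply: JK; rewrite inE eqxx.
Qed.

Definition delta (k i : T) : R := (i == k)%:R.

Definition wedge_deltas (K : seq T) z := foldr (fun k => wedge (delta k)) z K.

Lemma wedge_delta_notin k z s : k \notin s -> wedge (delta k) z s = 0.
Proof.
elim: s z => //= i s IH z; rewrite inE negb_or eq_sym => /andP[ik ks].
by rewrite /delta (negbTE ik) mul0r IH // subrr.
Qed.

Lemma wedge_deltas_cat K z s : uniq K -> {in s, forall i, i \notin K} ->
  wedge_deltas K z (K ++ s) = z s.
Proof.
elim: K => //= k K IH /andP[kK uK] sK.
rewrite /delta eqxx mul1r IH //; last first.
  by move=> i /sK; rewrite inE negb_or => /andP[].
rewrite wedge_delta_notin ?subr0 // mem_cat negb_or kK.
by apply/negP => /sK; rewrite inE eqxx.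
Qed.

(** Multiplying by [e_k] for [k] in [K] reduces the cocycle condition to the
    forms outside [K]: this lifts a class in the other variables by [size K]
    degrees. *)
Lemma wedge_deltas_cocycle g K z q J : is_ideal J ->
  (forall t, size t = q -> J (wedge (fun i => if i \in K then 0 else g i) z t)) ->
  forall s, size s = (size K + q)%N -> J (wedge g (wedge_deltas K z) s).
Proof.
move=> Ji; elim: K g => [|k K IH] g Jz s sq; first by apply: Jz.
pose g' i := if i == k then 0 else g i.
rewrite /= wedge_anti; apply: idealN => //.
have -> : wedge (delta k) (wedge g (wedge_deltas K z)) s =
    wedge (delta k) (wedge g' (wedge_deltas K z)) s.
  rewrite (@eq_wedge _ _ (fun t => wedge g' (wedge_deltas K z) t -
     (- g k) * wedge (delta k) (wedge_deltas K z) t)) => [|t].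
    by rewrite wedgeB wedgeZ wedge_sq mulr0 subr0.
  rewrite mulNr opprK -wedgeDl; apply: eq_wedgel => i.
  by rewrite /g' /delta; case: eqP => [->|_]; rewrite ?mulr1 ?mulr0 ?add0r ?addr0.
apply: wedge_ideal => // t st; apply: IH; last by move: sq; rewrite -st /= addSn => -[].
move=> t' tq; rewrite (@eq_wedgel _ (fun i => if i \in k :: K then 0 else g i)); first exact: Jz.
by move=> i; rewrite inE /g'; case: (i == k); case: (i \in K).
Qed.
End Koszul.

(** * Monomial supports and bounds on the depth *)

Lemma subn_shift k : (4 <= k)%N -> (k - 3 = k - 4 + 1)%N.
Proof. by case: k => [|[|[|[|k]]]] // _; rewrite !subSS !subn0 addn1. Qed.

Lemma uniq_size_le_ord n (s : seq 'I_n) : uniq s -> (size s <= n)%N.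
Proof. by move=> us; rewrite -[n in (_ <= n)%N]card_ord -(card_uniqP us) max_card. Qed.

Section Support.
Variables (K : fieldType) (n : nat).
Implicit Types (U V : 'X_{1..n} -> Prop) (m : 'X_{1..n}) (f g : {mpoly K[n]}).

Definition supp_in U f : Prop := forall m, m \in msupp f -> U m.
Definition mon_upset U : Prop := forall m m', U m -> U (m + m')%MM.

Lemma supp_inM U V W f g : (forall m m', U m -> V m' -> W (m + m')%MM) ->
  supp_in U f -> supp_in V g -> supp_in W (f * g).
Proof.
move=> UVW fU gV m /msuppM_le /allpairsP[[m1 m2] /= [/fU H1 /gV H2 ->]].
exact: UVW.
Qed.

Lemma supp_in_ideal U : mon_upset U -> is_ideal (supp_in U).
Proof.
move=> Uup; split=> [m|f g fU gU m|c f fU].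
- by rewrite msupp0.
- by move/msuppD_le; rewrite mem_cat => /orP[/fU|/gU].
apply: (@supp_inM (fun=> True) U) => // m m' _ Um.
by rewrite addmC; apply: Uup.
Qed.

Lemma supp_inX U m : supp_in U 'X_[m] <-> U m.
Proof.
split=> [H|Um m']; first by apply: H; rewrite msuppX inE.
by rewrite msuppX inE => /eqP->.
Qed.

Lemma supp_in_coef U f m : supp_in U f -> ~ U m -> f@_m = 0.
Proof. by move=> fU nU; apply: memN_msupp_eq0; apply/negP => /fU. Qed.

Lemma supp_in_gen (J : {mpoly K[n]} -> Prop) U f : is_ideal J ->
  (forall m, U m -> J 'X_[m]) -> supp_in U f -> J f.
Proof.
move=> Ji UJ fU; rewrite [f]mpolyE big_seq; apply: ideal_sum => // m /fU /UJ Jm.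
by rewrite -mul_mpolyC; apply: idealM.
Qed.

Lemma mcoeff_restrict (U : pred 'X_{1..n}) f m :
  (\sum_(m <- msupp f | U m) f@_m *: 'X_[m])@_m = if U m then f@_m else 0.
Proof.
rewrite raddf_sum /= -big_filter.
under eq_bigr do rewrite mcoeffZ mcoeffX.
have [fm|fm] := boolP (m \in msupp f); last first.
  rewrite memN_msupp_eq0 // if_same big1_seq // => m' /=.
  rewrite mem_filter => /andP[_ fm']; rewrite [m' == m]negbTE ?mulr0 //.
  by apply: contra fm => /eqP <-.
rewrite big_filter big_mkcond (bigD1_seq m) ?msupp_uniq //= eqxx mulr1.
rewrite big1 ?addr0 // => m' m'm; rewrite (negbTE m'm) mulr0; by case: ifP.
Qed.

Definition varpow N (i : 'I_n) : {mpoly K[n]} := 'X_[U_(i) *+ N].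

(** A monomial of degree more than [n * N] is divisible by some [x_i^N]. *)
Lemma maximal_in_radical N f : @graded_maximal_ideal K n f -> in_radical (varpow N) f.
Proof.
move=> fm.
have f1 : supp_in (fun m => 0 < mdeg m)%N f.
  apply: ideal_gen_min fm => [|g [i ->]]; last by apply/supp_inX; rewrite mdeg1.
  by apply: supp_in_ideal => m m' H; rewrite mdegD ltn_addr.
have fL L : supp_in (fun m => L <= mdeg m)%N (f ^+ L).
  elim: L => [//|L IH]; rewrite exprS; apply: supp_inM f1 IH => m m' H1 H2.
  by rewrite mdegD -add1n leq_add.
exists (n * N).+1.
pose J h := exists c : 'I_n -> {mpoly K[n]}, h = \sum_i c i * varpow N i.
have Ji : is_ideal J.
  split=> [|h k [c ->] [d ->]|c h [d ->]].
  - by exists (fun=> 0); rewrite big1 // => i _; rewrite mul0r.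
  - exists (fun i => c i + d i); rewrite -big_split; by apply: eq_bigr => i _; rewrite mulrDl.
  - exists (fun i => c * d i); rewrite mulr_sumr; by apply: eq_bigr => i _; rewrite mulrA.
apply: (supp_in_gen Ji _ (fL _)) => m mL.
have [i Ni] : exists i, (N <= m i)%N.
  apply: contrapT => none; move: mL; rewrite ltnNge mdegE => /negP; apply.
  rewrite -[X in (_ <= X * _)%N](card_ord n) -sum_nat_const; apply: leq_sum => i _.
  by rewrite leqNgt; apply/negP => /ltnW Ni; apply: none; exists i.
exists (fun j => if j == i then 'X_[m - U_(i) *+ N] else 0).
rewrite (bigD1 i) //= eqxx big1 => [|j /negbTE->]; last by rewrite mul0r.
rewrite addr0 -mpolyXD submK //; apply/mnm_lepP => j.
by rewrite mulmnE mnm1E; case: eqP => [<-|]; rewrite ?mul1n.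
Qed.

Lemma varpowX N i m : varpow N i * 'X_[m] = 'X_[m + U_(i) *+ N].
Proof. by rewrite mulrC -mpolyXD. Qed.

Lemma varpowE N (i j : 'I_n) : (U_(i) *+ N)%MM j = (if i == j then N else 0)%N.
Proof. by rewrite mulmnE mnm1E; case: eqP; rewrite ?mul1n. Qed.

Lemma coef_varpow N i f m : (varpow N i * f)@_(m + U_(i) *+ N) = f@_m.
Proof. by rewrite mulrC addmC mcoeffMX. Qed.

End Support.

Section TilingDecomposition.
Variables (K : fieldType) (n : nat) (I : {mpoly K[n]} -> Prop).
Hypothesis I_monomials : forall f, I f <-> supp_in (fun m => I 'X_[m]) f.

(** Distinct monomials outside [I] are linearly independent modulo [I]. *)
Lemma tiled_stanley_decomposition d : tiled d (fun m => ~ I 'X_[m]) ->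
  exists r (u : 'I_r -> 'X_{1..n}) (Z : 'I_r -> {set 'I_n}),
    stanley_decomposition I u Z /\ forall i, (d <= #|Z i|)%N.
Proof.
move=> [J [u [Z [c1 c2 c3 c4]]]].
exists #|J|, (fun i => u (enum_val i)), (fun i => Z (enum_val i)); split=> //.
have inj (i i' : 'I_#|J|) m : stanley_monomial (u (enum_val i)) (Z (enum_val i)) m ->
  stanley_monomial (u (enum_val i')) (Z (enum_val i')) m -> i = i'.
  by move=> mi mi'; apply/enum_val_inj/(c4 _ _ m).
split=> [i m|f|p pP sumI i]; first exact: c2.
  pose t (i : 'I_#|J|) m := `[< stanley_monomial (u (enum_val i)) (Z (enum_val i)) m >].
  have coefE i m := mcoeff_restrict (t i) f m.
  exists (fun i => \sum_(m <- msupp f | t i m) f@_m *: 'X_[m]) => [i m|].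
    rewrite mcoeff_msupp coefE; case: ifP => [/asboolP//|_]; by rewrite eqxx.
  apply/I_monomials => m; rewrite mcoeff_msupp mcoeffB raddf_sum /=.
  apply: contraNP => /c3[j mj]; apply/eqP.
  have tj : t (enum_rank j) m by apply/asboolP; rewrite enum_rankK.
  rewrite (bigD1 (enum_rank j)) //= coefE tj big1 ?addr0 ?subrr // => i ij.
  rewrite coefE; case: ifP => // /asboolP ti; case/eqP: ij.
  by apply: (inj _ _ m) => //; rewrite enum_rankK.
apply/I_monomials => m mi; have mI := pP i m mi.
case: (c2 _ _ mI); move/I_monomials: sumI; apply.
rewrite mcoeff_msupp raddf_sum /= (bigD1 i) //= big1 ?addr0 -?mcoeff_msupp //.
move=> i' i'i; apply: memN_msupp_eq0; apply/negP => /pP mi'.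
by case/eqP: i'i; apply: inj mi' mI.
Qed.
End TilingDecomposition.

Section Depth.
Variables (K : fieldType) (n B : nat) (E : 'I_n -> 'I_n -> nat -> nat -> bool).
Hypothesis EB : staircase_graph B E.
Variable I : {mpoly K[n]} -> Prop.
Hypothesis I_alive : forall f, I f <-> supp_in (fun m => ~ alive E m) f.

(* The exponent B at i already deletes every edge at i, while x_i^B is not
   divisible by x_i^N. *)
Let N := B.+1.
Let g := varpow K (n := n) N.

Lemma dead_upset : mon_upset (fun m => ~ alive E m).
Proof.
move=> m m' dead [i [j ij]]; apply: dead; exists i, j.
by apply: (staircase_down EB _ _ ij); rewrite mnmDE leq_addr.
Qed.

Lemma I_ideal : is_ideal I.
Proof. 
have -> : I = supp_in (fun m => ~ alive E m) by apply/funext => f; apply/propext.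
exact: supp_in_ideal dead_upset.
Qed.

Lemma I_X m : (forall i j, ~~ edge E m i j) -> I 'X_[m].
Proof. by move=> H; apply/I_alive/supp_inX => -[i [j]]; apply/negP. Qed.

Lemma edge_lt m i j : edge E m i j -> (m i < B)%N /\ (m j < B)%N.
Proof. by move=> ij; split; [apply: (staircase_bound EB ij)|apply: (staircase_bound2 EB ij)]. Qed.

Lemma edge_neq m i j : edge E m i j -> i != j.
Proof. by apply: contraTneq => ->; apply: (staircase_irr EB). Qed.

Lemma edge_irr m i : ~~ edge E m i i. Proof. exact: staircase_irr EB _ _ _. Qed.

Lemma edge_sym m i j : edge E m i j = edge E m j i.
Proof. exact: staircase_sym EB _ _ _ _. Qed.

Lemma eq_edge (m m' : 'X_{1..n}) i j : m i = m' i -> m j = m' j -> edge E m i j = edge E m' i j.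
Proof. by rewrite /edge => -> ->. Qed.

Lemma depth_le_koszul p : ~ koszul_exact g I p -> depth_le (@graded_maximal_ideal K n) I p.
Proof.
move=> nex fs fsm reg; rewrite leqNgt; apply/negP => lt; apply: nex.
apply: (regular_sequence_koszul I_ideal _ reg lt) => f /fsm.
exact: maximal_in_radical.
Qed.

(** Raising the coordinates in [s] deletes all edges that meet [s]. *)
Definition raise (s : seq 'I_n) (m : 'X_{1..n}) : 'X_{1..n} :=
  [multinom (if k \in s then B else m k) | k < n].

Lemma raiseE s m k : raise s m k = if k \in s then B else m k.
Proof. exact: mnmE. Qed.

Lemma edge_raise s m i j : edge E (raise s m) i j ->
  [/\ i \notin s, j \notin s & edge E m i j].
Proof.
move=> ij; have [] := edge_lt ij; rewrite !raiseE.
have [_|is_] := boolP (i \in s); first by rewrite ltnn.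
have [_|js] := boolP (j \in s); first by rewrite ltnn.
by split=> //; rewrite -(@eq_edge (raise s m)) // raiseE ifN.
Qed.

Lemma edge_varpow m k i j : edge E (m + U_(k) *+ N)%MM i j ->
  [/\ k != i, k != j & edge E m i j].
Proof.
have big x : (x + N < B)%N = false by rewrite ltnNge (leq_trans (leqnSn B)) ?leq_addl.
move=> ij; have [] := edge_lt ij; rewrite !mnmDE !varpowE.
have [_|ki] := eqVneq k i; first by rewrite big.
have [_|kj] := eqVneq k j; first by rewrite big.
split=> //; rewrite -(@eq_edge (m + U_(k) *+ N)%MM) //.
  by rewrite mnmDE varpowE (negbTE ki) addn0.
by rewrite mnmDE varpowE (negbTE kj) addn0.
Qed.

(** The exponents of the ideal generated by [I] and the [x_k^N] with [k] in
    [s], modulo which a coboundary simplifies by [wedge_cat]. *)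
Definition dead_or (s : seq 'I_n) (m : 'X_{1..n}) : Prop := ~ alive E m \/ exists2 k, k \in s & (N <= m k)%N.

Lemma dead_or_upset s : mon_upset (dead_or s).
Proof.
move=> m m' [dead|[k ks le]]; first by left; apply: dead_upset.
by right; exists k => //; rewrite mnmDE ltn_addr.
Qed.

Lemma dead_or_ideal s : is_ideal (supp_in (K := K) (dead_or s)).
Proof. exact/supp_in_ideal/dead_or_upset. Qed.

Lemma I_dead_or s f : I f -> supp_in (dead_or s) f.
Proof. by move=> /I_alive H m /H; left. Qed.

Lemma g_dead_or s k : k \in s -> supp_in (dead_or s) (g k).
Proof. by move=> ks; apply/supp_inX; right; exists k; rewrite // varpowE eqxx. Qed.

Lemma not_dead_or s (m m' : 'X_{1..n}) i j : edge E (raise s m + m')%MM i j ->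
  (forall k, k \in s -> m' k = 0%N) -> ~ dead_or s (raise s m + m')%MM.
Proof.
move=> ij m'0 [|[k ks]]; first by apply; exists i, j.
by rewrite mnmDE raiseE ks m'0 // addn0 ltnn.
Qed.

Lemma dead_or_cobound s z y t : 
  I (z (s ++ t) - wedge g y (s ++ t)) ->
  supp_in (dead_or s) (z (s ++ t) - (-1) ^+ size s * wedge g (fun u => y (s ++ u)) t).
Proof.
move=> /(@I_dead_or s) H1; have H2 := wedge_cat y t (dead_or_ideal s) (@g_dead_or s).
have := idealD (dead_or_ideal s) H1 H2; congr supp_in; ring.
Qed.

(** The class is [x^b] times the product of the [e_k] for all [k] other than [p]
    and [q].  It is a cocycle because [x_p^N] and [x_q^N] annihilate [x^b], which
    has only the edge [p q].  It is not a coboundary because [x^b] survives and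
    is divisible by no [x_k^N] with [k] different from [p] and [q]. *)
Lemma depth_le_edge m p q : edge E m p q -> depth_le (@graded_maximal_ideal K n) I (n - 2).
Proof.
move=> pq; apply: depth_le_koszul => ex.
pose s := enum (~: [set p; q]).
have ss : size s = (n - 2)%N by rewrite /s -cardE card_setC2 // (edge_neq pq).
have smem k : (k \in s) = ~~ ((k == p) || (k == q)) by rewrite mem_enum !inE.
pose b := raise s m.
have bE k : k \notin s -> b k = m k by rewrite raiseE => /negbTE ->.
have [ps qs] : p \notin s /\ q \notin s by rewrite !smem !eqxx orbT.
have [t ts|y yP] := ex (wedge_deltas s (fun=> 'X_[b])).
  apply: (@wedge_deltas_cocycle _ _ g s _ 1 I I_ideal); last by rewrite ss addn1.
  move=> [|i [|//]] // _; rewrite /= subr0.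
  case: ifPn => is_; first by rewrite mul0r; apply: ideal0 I_ideal.
  rewrite varpowX; apply: I_X => x y; apply/negP => /edge_varpow[ix iy].
  move=> /edge_raise[]; rewrite !smem !negbK => /orP[] /eqP xE /orP[] /eqP yE /edge_neq;
  move: is_ ix iy; rewrite smem negbK xE yE ?eqxx // => /orP[] /eqP->; by rewrite eqxx.
have := yP s ss; rewrite -[X in wedge_deltas _ _ X]cats0 -[X in wedge _ _ X]cats0.
move=> /(dead_or_cobound (z := wedge_deltas s (fun=> 'X_[b]))) /=.
rewrite wedge_deltas_cat ?enum_uniq // mulr0 subr0 => /supp_inX.
rewrite -[b]addm0; apply: (@not_dead_or s m 0%MM p q); last by move=> k _; rewrite mnm0E.
by rewrite addm0 (@eq_edge _ m) ?bE.
Qed.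

Lemma edge_2K2_uniq m p q r s : edge E m p q -> edge E m r s ->
  ~~ edge E m p r -> ~~ edge E m p s -> ~~ edge E m q r -> ~~ edge E m q s ->
  uniq [:: p; q; r; s].
Proof.
move=> pq rs pr ps qr qs.
have npr : p != r by apply: contraTneq rs => <-.
have nps : p != s by apply: contraTneq rs => <-; rewrite edge_sym.
have nqr : q != r by apply: contraTneq rs => <-.
have nqs : q != s by apply: contraTneq rs => <-; rewrite edge_sym.
by rewrite /= !inE !negb_or (edge_neq pq) (edge_neq rs) npr nps nqr nqs.
Qed.

Lemma edge_C5_uniq m p q r s t :
  edge E m p q -> edge E m q r -> edge E m r s -> edge E m s t -> edge E m t p ->
  ~~ edge E m p r -> ~~ edge E m p s -> ~~ edge E m q s -> ~~ edge E m q t ->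
  ~~ edge E m r t -> uniq [:: p; q; r; s; t].
Proof.
move=> pq qr rs st tp pr ps qs qt rt.
have npr : p != r by apply: contraTneq rs => <-.
have nps : p != s by apply: contraNneq pr => ->; rewrite edge_sym.
have nqs : q != s by apply: contraTneq st => <-.
have nqt : q != t by apply: contraNneq qs => ->; rewrite edge_sym.
have nrt : r != t by apply: contraTneq tp => <-; rewrite edge_sym.
have npt : p != t by rewrite eq_sym (edge_neq tp).
rewrite /= !inE !negb_or (edge_neq pq) (edge_neq qr) (edge_neq rs) (edge_neq st).
by rewrite npr nps nqs nqt nrt npt.
Qed.

(** The graph of [x^b] consists of the edges [p q] and [r s]: the punctured
    spectrum of its annihilator is disconnected, apart from the variables in
    [t].  The class comes from the idempotent that is 1 where [x_r] or [x_s] is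
    invertible and 0 where [x_p] or [x_q] is, lifted by the [e_k] with [k] in
    [t]. *)
Lemma depth_le_2K2 m p q r s : edge E m p q -> edge E m r s ->
  ~~ edge E m p r -> ~~ edge E m p s -> ~~ edge E m q r -> ~~ edge E m q s ->
  depth_le (@graded_maximal_ideal K n) I (n - 3).
Proof.
move=> pq rs pr ps qr qs; apply: depth_le_koszul => ex.
have u := edge_2K2_uniq pq rs pr ps qr qs.
have := u; rewrite /= !inE !negb_or !andbT => /and3P[/and3P[_ npr nps] /andP[nqr nqs] _].
pose t := enum [pred k | k \notin [:: p; q; r; s]].
have tmem k : (k \in t) = (k \notin [:: p; q; r; s]) by rewrite mem_enum.
have st : size t = (n - 4)%N.
  have := cardC (mem [:: p; q; r; s]); rewrite card_ord (card_uniqP u) /= => e.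
  have := congr1 (subn^~ 4) e; rewrite /= addKn => <-.
  by rewrite /t -cardE; apply: eq_card => k; rewrite !inE.
have n4 : (4 <= n)%N := uniq_size_le_ord u.
pose b := raise t m.
have bE k : k \notin t -> b k = m k by rewrite raiseE => /negbTE ->.
have [pt qt rt st'] : [/\ p \notin t, q \notin t, r \notin t & s \notin t].
  by rewrite !tmem !inE !eqxx !orbT.
pose z0 (x : seq 'I_n) := if x is i :: _ then
   (if (i == r) || (i == s) then g i * 'X_[b] else 0) else 0.
have t_rs i : i \in t -> (i == r) || (i == s) = false.
  by rewrite tmem !inE => /norP[_ /norP[_ /negbTE]].
have mixed i j : (i == p) || (i == q) -> (j == r) || (j == s) ->
    I (g i * (g j * 'X_[b])).
  move=> ipq jrs; rewrite !varpowX; apply: I_X => x y; apply/negP.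
  move=> /edge_varpow[ix iy] /edge_varpow[jx jy] /edge_raise[xt yt xy].
  have rp : ~~ edge E m r p by rewrite edge_sym.
  have rq : ~~ edge E m r q by rewrite edge_sym.
  have sp : ~~ edge E m s p by rewrite edge_sym.
  have sq : ~~ edge E m s q by rewrite edge_sym.
  have rest z : z \notin t -> i != z -> j != z ->
      z = (if i == p then q else p) \/ z = (if j == r then s else r).
    rewrite tmem negbK !inE; move: ipq jrs; rewrite -[_ || (i == q)]orbC.
    case: (eqVneq i p) => [->|_]; case: (eqVneq j r) => [->|_] /=; rewrite ?orbT ?orbF;
    move=> H1 H2 /or4P[]/eqP ->; rewrite ?eqxx //; auto;
    by rewrite ?(eqP H1) ?(eqP H2) eqxx.
  have xny := edge_neq xy.
  case: (rest x xt ix jx) (rest y yt iy jy) xy xny => -> [] ->; rewrite ?eqxx //;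
  by case: (i == p); case: (j == r); move=> + _; apply/negP.
have notin_t i : i \notin t -> ((i == p) || (i == q)) || ((i == r) || (i == s)).
  by rewrite tmem negbK !inE -!orbA.
have pq_rs i : (i == p) || (i == q) -> (i == r) || (i == s) = false.
  by case/orP => /eqP->; apply/negbTE; rewrite negb_or ?npr ?nps ?nqr ?nqs.
have [x xs|y yP] := ex (wedge_deltas t z0).
  apply: (@wedge_deltas_cocycle _ _ g t _ 2 I I_ideal); last by rewrite xs st (subn_shift n4) -addnS.
  move=> [|i [|j [|//]]] // _; rewrite /= subr0.
  have [it|it] /= := boolP (i \in t).
    by rewrite (t_rs i it) mul0r mulr0 subr0; apply: ideal0 I_ideal.
  have [jt|jt] /= := boolP (j \in t).
    by rewrite (t_rs j jt) mul0r mulr0 subr0; apply: ideal0 I_ideal.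
  have [ipq|irs] := orP (notin_t _ it); have [jpq|jrs] := orP (notin_t _ jt).
  - by rewrite (pq_rs i ipq) (pq_rs j jpq) !mulr0 subr0; apply: ideal0 I_ideal.
  - by rewrite jrs (pq_rs i ipq) mulr0 subr0; apply: mixed.
  - rewrite irs (pq_rs j jpq) mulr0 sub0r; apply: idealN I_ideal _; exact: mixed.
  - by rewrite irs jrs mulrCA subrr; apply: ideal0 I_ideal.
(* If the class were a coboundary, [eta] would be congruent to [x^b] on one
   component and to 0 on the other; compare its coefficients at [b]. *)
pose eta := (-1) ^+ size t * y t.
have H i : i \notin t -> supp_in (dead_or t) (z0 [:: i] - g i * eta).
  move=> it; have sti : size (t ++ [:: i]) = (n - 3)%N by rewrite size_cat st /= (subn_shift n4).
  have := yP _ sti => /(dead_or_cobound (z := wedge_deltas t z0)).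
  rewrite wedge_deltas_cat ?enum_uniq //=; last by move=> k; rewrite inE => /eqP->.
  rewrite subr0 cats0 /eta; congr supp_in; ring.
have alive_b i x y' : i \notin t -> x \notin t -> y' \notin t -> edge E m x y' ->
   i != x -> i != y' -> ~ dead_or t (b + U_(i) *+ N)%MM.
  move=> it xt yt xy ix iy; apply: (@not_dead_or _ _ _ x y').
    rewrite (@eq_edge _ m) // mnmDE varpowE ?(negbTE ix) ?(negbTE iy) addn0 -/b bE //.
  by move=> k kt; rewrite varpowE; case: eqP => // ik; rewrite -ik (negbTE it) in kt.
have Hr := supp_in_coef (H r rt) (alive_b r p q rt pt qt pq _ _).
have Hp := supp_in_coef (H p pt) (alive_b p r s pt rt st' rs npr nps).
move: Hp; rewrite /z0 pq_rs ?eqxx // mcoeffB mcoeff0 coef_varpow sub0r => /eqP.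
rewrite oppr_eq0 => /eqP eta0.
move: Hr; rewrite /z0 eqxx /= mcoeffB !coef_varpow eta0 mcoeffX eqxx subr0.
rewrite ![r == _]eq_sym npr nqr => /(_ isT isT) /eqP.
by rewrite oner_eq0.
Qed.

(** The complements of the edges of a pentagon are the triples of consecutive
    vertices, which triangulate a Moebius strip, and the class is a generator of
    its first cohomology. *)
Lemma depth_le_C5 m p q r s t : (n <= 5)%N ->
  edge E m p q -> edge E m q r -> edge E m r s -> edge E m s t -> edge E m t p ->
  ~~ edge E m p r -> ~~ edge E m p s -> ~~ edge E m q s -> ~~ edge E m q t ->
  ~~ edge E m r t -> depth_le (@graded_maximal_ideal K n) I 2.
Proof.
move=> n5 pq qr rs st tp pr ps qs qt rt; apply: depth_le_koszul => ex.
pose w := [:: p; q; r; s; t].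
have u : uniq w := edge_C5_uniq pq qr rs st tp pr ps qs qt rt.
pose ix i := index i w; pose v := nth p w.
have w_all i : i \in w.
  have le5 : (size (enum 'I_n) <= size w)%N by rewrite size_enum_ord.
  by have [_ ->] := uniq_min_size u (fun i _ => mem_enum 'I_n i) le5; rewrite mem_enum.
have ixv k : (k < 5)%N -> ix (v k) = k by move=> k5; rewrite /ix index_uniq.
have ix_lt i : (ix i < 5)%N by rewrite /ix -[5%N]/(size w) index_mem.
have vix i : v (ix i) = i by rewrite /v nth_index.
pose adj (a b : nat) : bool := ((b == a.+1 %% 5) || (a == b.+1 %% 5))%N.
have edge_adj x y : edge E m x y -> adj (ix x) (ix y).
  apply: contraTT; rewrite -{2}[x]vix -{2}[y]vix.
  have := edge_irr m; move: (ix x) (ix y) (ix_lt x) (ix_lt y).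
  have [rp sp sq [tq tr]] : [/\ ~~ edge E m r p, ~~ edge E m s p, ~~ edge E m s q &
    ~~ edge E m t q /\ ~~ edge E m t r] by rewrite !(edge_sym m s) (edge_sym m r) !(edge_sym m t).
  by do 5?[case=> [|]]; do 5?[case=> [|]] => //.
(* The generator takes the value 1 on the edges 01, 02 and 41, so that it
   vanishes around each triangle but has total 1 around 0, 1, 2, 3, 4; hence
   it is not a coboundary in any characteristic. *)
pose f (a b : nat) : nat := ((a == 0) && ((b == 1) || (b == 2)) || (a == 4) && (b == 1))%N.
have face (a b c : nat) : (a < 5)%N -> (b < 5)%N -> (c < 5)%N ->
   (f b c + f c a + f a b = f c b + f a c + f b a)%N \/
   forall x y : nat, (x < 5)%N -> (y < 5)%N -> adj x y -> x \notin [:: a; b; c] -> y \in [:: a; b; c].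
  pose P (a b c : nat) := (f b c + f c a + f a b == f c b + f a c + f b a)%N ||
    all (fun x => all (fun y => adj x y ==> (x \notin [:: a; b; c]) ==> (y \in [:: a; b; c]))
      (iota 0 5)) (iota 0 5).
  have : all (fun a => all (fun b => all (P a b) (iota 0 5)) (iota 0 5)) (iota 0 5) by [].
  have io k : (k < 5)%N -> k \in iota 0 5 by move=> k5; rewrite mem_iota.
  move=> H a5 b5 c5; have := allP (allP (allP H a (io a a5)) b (io b b5)) c (io c c5).
  case/orP=> [/eqP|H']; [by left|right => x y x5 y5].
  by have := allP (allP H' x (io x x5)) y (io y y5) => /implyP H1 /H1 /implyP.
pose lam i j : {mpoly K[n]} := (f (ix i) (ix j))%:R - (f (ix j) (ix i))%:R.
pose z (l : seq 'I_n) : {mpoly K[n]} :=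
  if l is [:: i; j] then lam i j * (g i * (g j * 'X_[m])) else 0.
have [l l3|y yP] := ex z.
  move: l l3 => [|i [|j [|k [|//]]]] // _; rewrite /= !subr0.
  have -> : g i * (lam j k * (g j * (g k * 'X_[m]))) -
     (g j * (lam i k * (g i * (g k * 'X_[m]))) - g k * (lam i j * (g i * (g j * 'X_[m])))) =
     (lam j k - lam i k + lam i j) * (g i * (g j * (g k * 'X_[m]))) by ring.
  have [coc|nonface] := face _ _ _ (ix_lt i) (ix_lt j) (ix_lt k).
    have -> : lam j k - lam i k + lam i j = 0.
      move/(congr1 (fun a : nat => a%:R : {mpoly K[n]})): coc; rewrite !natrD => coc.
      rewrite /lam; move: coc; set A := (f _ _)%:R; set A2 := (f _ _)%:R; set A3 := (f _ _)%:R.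
      set A4 := (f _ _)%:R; set A5 := (f _ _)%:R; set A6 := (f _ _)%:R => coc.
      have -> : A - A4 - (A5 - A2) + (A3 - A6) = (A + A2 + A3) - (A4 + A5 + A6) by ring.
      by rewrite coc subrr.
    by rewrite mul0r; apply: ideal0 I_ideal.
  apply: idealM I_ideal _; rewrite !varpowX; apply: I_X => x x'; apply/negP.
  move=> /edge_varpow[ix1 iy1] /edge_varpow[jx jy] /edge_varpow[kx ky xy].
  have neq a b : a != b -> ix b != ix a.
    by apply: contra => /eqP e; rewrite -[a]vix -[b]vix e.
  have := nonface _ _ (ix_lt x) (ix_lt x') (edge_adj _ _ xy).
  rewrite !inE (negbTE (neq _ _ ix1)) (negbTE (neq _ _ iy1)) (negbTE (neq _ _ jx)).
  by rewrite (negbTE (neq _ _ jy)) (negbTE (neq _ _ kx)) (negbTE (neq _ _ ky)) => /(_ isT).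
pose eta i := (y [:: i])@_(m + U_(i) *+ N).
have sep i j : ix i != ix j -> i != j by apply: contraNneq => ->.
have H i j a b : edge E m a b ->
    [&& ix i != ix a, ix i != ix b, ix j != ix a, ix j != ix b & ix i != ix j] ->
    (f (ix i) (ix j))%:R - (f (ix j) (ix i))%:R = eta j - eta i.
  move=> ab /and5P[/sep ia /sep ib /sep ja /sep jb /sep ij]; have /I_alive H := yP [:: i; j] erefl.
  have al : ~ ~ alive E (m + U_(j) *+ N + U_(i) *+ N)%MM.
    apply; exists a, b; rewrite (@eq_edge _ m) // !mnmDE !varpowE.
      by rewrite (negbTE ia) (negbTE ja) !addn0.
    by rewrite (negbTE ib) (negbTE jb) !addn0.
  have := supp_in_coef H al; rewrite /= !subr0.
  have -> : lam i j = ((f (ix i) (ix j))%:R - (f (ix j) (ix i))%:R)%:MP.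
    by rewrite /lam mpolyCB !mpolyC_nat.
  rewrite !mcoeffB mcoeffCM !coef_varpow mcoeffX eqxx mulr1.
  have -> : (m + U_(j) *+ N + U_(i) *+ N = m + U_(i) *+ N + U_(j) *+ N)%MM.
    by rewrite -!addmA [X in (m + X)%MM]addmC.
  by rewrite coef_varpow => /eqP; rewrite subr_eq0 => /eqP.
have ixE := (ixv 0 isT, ixv 1 isT, ixv 2 isT, ixv 3 isT, ixv 4 isT)%N; rewrite /v /= in ixE.
have := H p q r s rs; rewrite !ixE => /(_ isT) e01.
have := H q r s t st; rewrite !ixE => /(_ isT) e12.
have := H r s t p tp; rewrite !ixE => /(_ isT) e23.
have := H s t p q pq; rewrite !ixE => /(_ isT) e34.
have := H t p q r qr; rewrite !ixE => /(_ isT) e40.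
have /eqP : (1 : K) = 0; last by rewrite oner_eq0.
rewrite -[1](subr0 1) [LHS]e01.
have -> : eta q - eta p = - ((eta r - eta q) + (eta s - eta r) + (eta t - eta s) +
  (eta p - eta t)) by ring.
by rewrite -e12 -e23 -e34 -e40 !subrr !addr0 oppr0.
Qed.
End Depth.

(** * Staircases from associated primes *)

Section Dickson.
Local Open Scope nat_scope.

(** Each next index minimizes [f] over the remaining ones. *)
Lemma nondecreasing_subsequence (f : nat -> nat) :
  exists phi : nat -> nat, (forall a b, a < b -> phi a < phi b) /\
    forall a b, a <= b -> f (phi a) <= f (phi b).
Proof.
have /choice[mu muP] : forall a, exists i, a <= i /\ forall j, a <= j -> f i <= f j.
  move=> a; have ex : exists v, `[< exists2 i, a <= i & f i = v >].
    by exists (f a); apply/asboolP; exists a.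
  have [v /asboolP[i ai <-] vmin] := ex_minnP ex.
  by exists i; split=> // j aj; apply: vmin; apply/asboolP; exists j.
pose phi := fix phi k := if k is k'.+1 then mu (phi k').+1 else mu 0.
have phiS k : phi k < phi k.+1 by case: (muP (phi k).+1).
exists phi; split; first exact: (homo_ltn ltn_trans phiS).
apply: (homo_leq leqnn leq_trans) => k.
have min j : phi k <= j -> f (phi k) <= f j.
  case: k => [|k] /= le; first by apply: (muP 0).2.
  by apply: (muP _).2; apply: leq_trans le; apply: (muP _).1.
exact/min/ltnW/phiS.
Qed.

Variable n : nat.
Implicit Types (U : 'X_{1..n} -> Prop) (m : 'X_{1..n}).

Lemma nondecreasing_multinom_subsequence (F : nat -> 'X_{1..n}) :
  exists phi : nat -> nat, (forall a b, a < b -> phi a < phi b) /\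
    forall k a b, a <= b -> F (phi a) k <= F (phi b) k.
Proof.
suff H (s : seq 'I_n) : exists phi : nat -> nat, (forall a b, a < b -> phi a < phi b) /\
    forall k a b, k \in s -> a <= b -> F (phi a) k <= F (phi b) k.
  have [phi [H1 H2]] := H (enum 'I_n); exists phi; split=> // k a b.
  by apply: H2; rewrite mem_enum.
elim: s => [|k s [phi [H1 H2]]]; first by exists id.
have [psi [H3 H4]] := nondecreasing_subsequence (fun a => F (phi a) k).
have psi_le a b : a <= b -> psi a <= psi b.
  by rewrite leq_eqVlt => /orP[/eqP->//|/H3/ltnW].
exists (phi \o psi); split=> [a b /H3/H1//|i a b /=].
by rewrite inE => /orP[/eqP->|is_] ab; [apply: H4|apply: H2 => //; apply: psi_le].
Qed.

Definition truncate N m : 'X_{1..n} := [multinom minn (m i) N | i < n].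

Lemma mon_upset_le U m m' : mon_upset U -> (m <= m')%MM -> U m -> U m'.
Proof. by move=> Uup mm' Um; rewrite -(submK mm') addmC; apply: Uup. Qed.

(** Otherwise some [F N] lies in [U] while its truncation at [N] does not, for
    every [N].  Along a nondecreasing subsequence a late term dominates the first
    one, even after truncation. *)
Lemma dickson U : mon_upset U -> exists N, forall m, U m -> U (truncate N m).
Proof.
move=> Uup; apply: contrapT => noN.
have /choice[F FP] : forall N, exists m, U m /\ ~ U (truncate N m).
  move=> N; apply: contrapT => H; apply: noN; exists N => m Um.
  by apply: contrapT => nU; apply: H; exists m.
have [phi [phi_lt Fphi]] := nondecreasing_multinom_subsequence F.
have phi_ge k : k <= phi k.
  by elim: k => // k IH; apply: leq_ltn_trans IH (phi_lt _ _ (ltnSn k)).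
pose d := mdeg (F (phi 0)); apply: (FP (phi d)).2.
apply: mon_upset_le Uup _ (FP (phi 0)).1; apply/mnm_lepP => i.
rewrite mnmE leq_min Fphi //= (leq_trans _ (phi_ge d)) // /d mdegE.
by rewrite (bigD1 i) //= leq_addr.
Qed.

(** Take [b] of maximal degree outside [U] within the box between [m] and the
    coordinatewise maximum of [m] and [N].  The directions in [s] are those in
    which one step enters [U]; the others are stopped by the box. *)
Lemma upset_socle U N : mon_upset U -> (forall m, U m -> U (truncate N m)) ->
  forall m, ~ U m -> exists (b : 'X_{1..n}) (s : seq 'I_n),
    [/\ uniq s, (m <= b)%MM, ~ U b, forall i, i \in s -> U (b + U_(i))%MM
      & forall i, i \notin s -> N <= b i].
Proof.
move=> Uup UN m nUm.
pose box b := [/\ (m <= b)%MM, forall i, b i <= maxn (m i) N & ~ U b].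
have ex : exists d, `[< exists2 b, box b & mdeg b = d >].
  exists (mdeg m); apply/asboolP; exists m => //; split=> // [|i]; first exact: lepm_refl.
  exact: leq_maxl.
have bd d : `[< exists2 b, box b & mdeg b = d >] -> d <= \sum_i maxn (m i) N.
  by move=> /asboolP[b [_ bN _] <-]; rewrite mdegE; apply: leq_sum => i _.
have [d /asboolP[b [mb bN nUb] <-] dmax] := ex_maxnP ex bd.
exists b, [seq i <- enum 'I_n | `[< U (b + U_(i))%MM >]]; split=> // [||i].
- by rewrite filter_uniq // enum_uniq.
- by move=> i; rewrite mem_filter => /andP[/asboolP].
rewrite mem_filter mem_enum andbT => /asboolP nUi.
rewrite leqNgt; apply/negP => bi.
suff /dmax : `[< exists2 b', box b' & mdeg b' = (mdeg b).+1 >] by rewrite ltnn.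
apply/asboolP; exists (b + U_(i))%MM; last by rewrite mdegD mdeg1 addn1.
split=> // [|j]; first by apply: lepm_trans mb (lem_addr _ _).
rewrite mnmDE mnm1E; case: eqP => [<-|_]; last by rewrite addn0.
by rewrite addn1 leq_max bi orbT.
Qed.

Lemma truncate_socle U N b m : mon_upset U -> (forall m, U m -> U (truncate N m)) ->
  ~ U b -> (forall i, minn (m i) N <= b i) -> ~ U m.
Proof.
move=> Uup UN nUb le /UN; apply: contra_not nUb; apply: mon_upset_le => //.
by apply/mnm_lepP => i; rewrite mnmE.
Qed.
End Dickson.

Section VariablePrimes.
Variables (K : fieldType) (n : nat).
Implicit Types (s : seq 'I_n) (f g : {mpoly K[n]}) (m : 'X_{1..n}).

Definition touches s m : Prop := exists2 i, i \in s & (0 < m i)%N.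
Definition var_ideal s : {mpoly K[n]} -> Prop := supp_in (touches s).

Lemma touches_upset s : mon_upset (touches s).
Proof. by move=> m m' [i si mi]; exists i => //; rewrite mnmDE ltn_addr. Qed.

Lemma var_ideal_ideal s : is_ideal (var_ideal s).
Proof. exact/supp_in_ideal/touches_upset. Qed.

Lemma var_ideal_remainder s f : ~ var_ideal s f ->
  exists g, [/\ var_ideal s (f - g), g != 0 & forall m, m \in msupp g -> ~ touches s m].
Proof.
move=> nf; pose g := \sum_(m <- msupp f | ~~ `[< touches s m >]) f@_m *: 'X_[m].
have gE m : g@_m = if ~~ `[< touches s m >] then f@_m else 0 by apply: mcoeff_restrict.
exists g; split=> [m||m].
- rewrite mcoeff_msupp mcoeffB gE; case: asboolP => //= _.
  by rewrite subrr eqxx.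
- apply: contra_notN nf => /eqP g0 m fm; apply: contrapT => tm.
  by have := gE m; rewrite g0 mcoeff0 (introF (asboolP _) tm) => /esym/eqP; rewrite mcoeff_eq0 fm.
by rewrite mcoeff_msupp gE; case: asboolP => //=; rewrite eqxx.
Qed.

(** Discard from both factors the terms that touch [s]; the product of the
    leading monomials of the remainders does not touch [s]. *)
Lemma var_ideal_prime s : is_prime_ideal (var_ideal s).
Proof.
have Pi := var_ideal_ideal s; split=> // [|f g fg].
  by rewrite -mpolyX0 => /supp_inX[i _]; rewrite mnm0E.
apply: contrapT => /not_orP[/var_ideal_remainder[f' [ff' f0 fs]] /var_ideal_remainder[g' [gg' g0 gs]]].
have fg' : var_ideal s (f' * g').
  have -> : f' * g' = f * g - (g * (f - f') + f' * (g - g')) by ring.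
  by apply: (idealB Pi fg); apply: (idealD Pi); apply: (idealM _ Pi).
have /fg'[i si] : (mlead f' + mlead g')%MM \in msupp (f' * g').
  by rewrite -mleadM // mlead_supp // mulf_neq0.
rewrite mnmDE addn_gt0 => /orP[mi|mi].
  by case: (fs _ (mlead_supp f0)); exists i.
by case: (gs _ (mlead_supp g0)); exists i.
Qed.

Lemma var_ideal_chain s : uniq s ->
  prime_chain (var_ideal s) (size s) (fun i => var_ideal (take i s)).
Proof.
move=> us; split=> [i _|i is_|f]; last by rewrite take_size.
  exact: var_ideal_prime.
case: s us is_ => // x0 s' us is_; set s := x0 :: s' in us is_ *.
have tS := take_nth x0 is_; split=> [f fi m /fi[j ji mj]|].
  by exists j => //; rewrite tS mem_rcons inE ji orbT.
exists 'X_(nth x0 s i).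
  by apply/supp_inX; exists (nth x0 s i); rewrite ?mnm1E ?eqxx // tS mem_rcons inE eqxx.
move=> /supp_inX[j ji]; rewrite mnm1E; case: eqP => // e _.
have := us; rewrite -(cat_take_drop i s) (drop_nth x0 is_) cat_uniq => /and3P[_ + _].
by rewrite /= negb_or e ji.
Qed.

Lemma var_ideal1_divisible (j : 'I_n) f : var_ideal [:: j] f -> exists h, f = 'X_j * h.
Proof.
apply: (@supp_in_gen _ _ (fun f => exists h, f = 'X_j * h)) => [|m [i]].
  split=> [|f1 f2 [h1 ->] [h2 ->]|c f1 [h ->]]; first by exists 0; rewrite mulr0.
    by exists (h1 + h2); rewrite mulrDr.
  by exists (c * h); rewrite mulrCA.
rewrite inE => /eqP-> mj; exists 'X_[m - U_(j)].
by rewrite -mpolyXD addmC submK // lep1mP -lt0n.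
Qed.

(** Dividing a nonzero element of [Q] by [x_j] stays in [Q] unless [x_j] lies in
    [Q], and the degree decreases. *)
Lemma prime_in_principal (j : 'I_n) (Q : {mpoly K[n]} -> Prop) f : is_prime_ideal Q ->
  (forall g, Q g -> var_ideal [:: j] g) -> Q f -> f != 0 -> Q 'X_j.
Proof.
move=> [Qi Q1 Qp] QP; have [k] := ubnP (msize f); elim: k f => // k IH f fk Qf f0.
have [h fE] := var_ideal1_divisible (QP f Qf); rewrite fE in Qf f0 fk.
have [//|Qh] := Qp _ _ Qf.
have h0 : h != 0 by apply: contraNneq f0 => ->; rewrite mulr0.
apply: (IH h) => //; move: fk; rewrite msizeM ?msizeX ?mdeg1 //.
by rewrite -msize_poly_eq0 msizeX.
Qed.

Lemma var_ideal_height s h : uniq s -> has_height (var_ideal s) h -> (size s <= h)%N.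
Proof. by move=> us [_]; apply; apply: var_ideal_chain. Qed.

(** Three variables give a chain of length 3.  With at most one variable, the
    middle term of a chain of length 2 is a nonzero prime inside [(x_j)], hence
    equal to it. *)
Lemma var_ideal_height2 s : uniq s -> has_height (var_ideal s) 2 -> size s = 2.
Proof.
move=> us ht; apply/eqP; rewrite eqn_leq (var_ideal_height us ht) /=.
case: ht => -[c [cp cs cP]] _.
have [_ [x c2x nc1x]] := cs 1%N isT; have [c01 [y c1y nc0y]] := cs 0%N isT.
have [c12 _] := cs 1%N isT.
have [[Q0 _ _] _ _] := cp 0%N isT; have y0 : y != 0 by apply: contra_notN nc0y => /eqP->.
case: s us cP => [|j [|//]] us cP.
  by have [i] := (cP y).1 (c12 y c1y) _ (mlead_supp y0).
have c1X : c 1%N 'X_j.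
  apply: (prime_in_principal (cp 1%N isT) _ c1y y0) => g /c12 /cP //.
have [c1i _ _] := cp 1%N isT.
have /cP/var_ideal1_divisible[h xE] := c2x.
by case: nc1x; rewrite xE mulrC; apply: idealM.
Qed.
End VariablePrimes.

Section Staircase.
Variables (K : fieldType) (n : nat) (I : {mpoly K[n]} -> Prop).
Hypothesis hI : is_monomial_ideal I.
Hypothesis hass : forall P : {mpoly K[n]} -> Prop, associated_prime I P -> has_height P 2.

Lemma monomial_ideal_ideal : is_ideal I.
Proof.
have [A AI] := hI.
have -> : I = ideal_gen (fun g => exists2 m, A m & g = 'X_[m]).
  by apply/funext => f; apply/propext.
exact: ideal_gen_ideal.
Qed.

Lemma mon_upset_I : mon_upset (fun m => I 'X_[m]).
Proof.
by move=> m m' Im; rewrite mpolyXD mulrC; apply: idealM => //; apply: monomial_ideal_ideal.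
Qed.

Lemma monomial_idealE f : I f <-> supp_in (fun m => I 'X_[m]) f.
Proof.
split; last by apply: supp_in_gen => //; exact: monomial_ideal_ideal.
have [A AI] := hI; move/AI; apply: ideal_gen_min.
  exact: supp_in_ideal mon_upset_I.
move=> g [m Am ->]; apply/supp_inX/AI; apply: ideal_gen_incl; by exists m.
Qed.

(** The annihilator of [x^b] modulo [I] is generated by the variables in [s], so
    it is an associated prime. *)
Lemma socle_associated N : (forall m, I 'X_[m] -> I 'X_[truncate N m]) ->
  forall m, ~ I 'X_[m] -> exists (b : 'X_{1..n}) (s : seq 'I_n),
    [/\ uniq s /\ size s = 2, (m <= b)%MM, ~ I 'X_[b], forall i, i \in s -> I 'X_[b + U_(i)]
      & forall i, i \notin s -> (N <= b i)%N].
Proof.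
move=> UN m nm; have [b [s [us mb nb sI sN]]] := upset_socle mon_upset_I UN nm.
exists b, s; split=> //; split=> //; apply: (@var_ideal_height2 K) => //; apply: hass.
split; first exact: var_ideal_prime.
exists 'X_[b] => f; rewrite monomial_idealE; split=> [fs m'|H m' fm'].
  rewrite (perm_mem (msuppMX _ _)) => /mapP[m1 /fs[i si mi] ->].
  apply: (mon_upset_le mon_upset_I _ (sI i si)); apply/mnm_lepP => j.
  rewrite !mnmDE mnm1E leq_add2l; by case: eqP => [<-|].
have := H (b + m')%MM; rewrite (perm_mem (msuppMX _ _)) map_f // => /(_ isT) Ibm.
apply: contrapT => nt; case: (truncate_socle mon_upset_I UN nb _ Ibm) => i.
have [si|si] := boolP (i \in s); last by apply: leq_trans (sN i si); apply: geq_minr.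
rewrite mnmDE geq_min [m' i](_ : _ = 0)%N ?addn0 ?leqnn //.
by apply/eqP; rewrite -leqn0 leqNgt; apply/negP => mi; apply: nt; exists i.
Qed.

Definition place (i j : 'I_n) (s t M : nat) : 'X_{1..n} :=
  [multinom (if k == i then s else if k == j then t else M) | k < n].

(** Localizing at the variables other than [x_i] and [x_j]: the exponents of
    the complement of the primary component of [(x_i, x_j)]. *)
Definition staircase (i j : 'I_n) (s t : nat) : bool :=
  (i != j) && `[< forall M, ~ I 'X_[place i j s t M] >].

Lemma monomial_ideal_staircase : exists B,
  staircase_graph B staircase /\ forall m, alive staircase m <-> ~ I 'X_[m].
Proof.
have [N UN] := dickson mon_upset_I; exists N.
have down i j s t s' t' : (s' <= s)%N -> (t' <= t)%N -> staircase i j s t -> staircase i j s' t'.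
  move=> ss' tt' /andP[ij /asboolP H]; rewrite /staircase ij; apply/asboolP => M HM.
  apply: (H M); apply: (mon_upset_le mon_upset_I _ HM); apply/mnm_lepP => k.
  by rewrite !mnmE; do 2!case: ifP => // _.
split.
  split=> // [i s t|i j s t|i j s t]; first by rewrite /staircase eqxx.
    rewrite /staircase eq_sym; have [//|ij] := eqVneq j i; congr `[< _ >].
    apply/propext; split=> H M; have := H M; congr (~ I 'X_[_]); apply/mnmP => k;
    rewrite !mnmE; by case: (eqVneq k i) => [->|]; rewrite ?[i == j]eq_sym ?(negbTE ij).
  move=> /andP[ij /asboolP /(_ N) H]; rewrite ltnNge; apply/negP => Ns.
  have [b [q [[uq q2] mb nb qI qN]]] := socle_associated UN H.
  have qj k : k \in q -> k = j.
    move=> kq; apply: contrapT => /eqP kj.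
    case: (truncate_socle mon_upset_I UN nb _ (qI k kq)) => l.
    rewrite mnmDE mnm1E; case: eqP => [<-|_]; last by rewrite addn0 geq_minl.
    rewrite geq_min; apply/orP; right; have /mnm_lepP/(_ k) := mb; rewrite mnmE (negbTE kj).
    by apply: leq_trans; case: ifP.
  case: q uq q2 qj {qI qN} => [|x [|y [|//]]] //= uq _ qj.
  have xj := qj x (mem_head _ _); have yj : y = j by apply: qj; rewrite !inE eqxx orbT.
  by move: uq; rewrite xj yj inE eqxx.
move=> m; split=> [[i [j /andP[ij /asboolP H]]] Im|nm].
  apply: (H (mdeg m)); apply: (mon_upset_le mon_upset_I _ Im); apply/mnm_lepP => k.
  rewrite mnmE; case: eqP => [->//|_]; case: eqP => [->//|_].
  by rewrite mdegE (bigD1 k) //= leq_addr.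
have [b [q [[uq q2] mb nb qI qN]]] := socle_associated UN nm.
case: q uq q2 qN {qI} => [|i [|j [|//]]] //= uq _ qN.
have ij : i != j by move: uq; rewrite inE andbT.
exists i, j; apply: (down _ _ (b i) (b j)); try exact: (mnm_lepP mb).
rewrite /staircase ij; apply/asboolP => M; apply: (truncate_socle mon_upset_I UN nb) => k.
rewrite mnmE; case: (eqVneq k i) => [->|ki]; first exact: geq_minl.
case: (eqVneq k j) => [->|kj]; first exact: geq_minl.
by apply: leq_trans (geq_minr _ _) (qN k _); rewrite !inE negb_or ki.
Qed.
End Staircase.

(** * The theorem *)

Lemma eq4_or_5 k : (4 <= k)%N -> (k <= 5)%N -> k = 4 \/ k = 5.
Proof. by case: k => [|[|[|[|[|[|]]]]]] //; auto. Qed.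

Theorem corollary2p3 (K : fieldType) (n : nat) (hn : (n <= 5)%N)
    (I : {mpoly K[n]} -> Prop) (hI : is_monomial_ideal I)
    (hass : forall P : {mpoly K[n]} -> Prop,
        associated_prime I P -> has_height P 2) :
  is_stanley_ideal I.
Proof.
have [B [EB aliveE]] := monomial_ideal_staircase hI hass.
set E := staircase I in EB aliveE.
have IE := monomial_idealE hI.
have I_alive f : I f <-> supp_in (fun m => ~ alive E m) f.
  rewrite IE; split=> H m /H; first by move=> Im /aliveE.
  by move=> dead; apply: contrapT => /aliveE.
have conclude d : tiled d (alive E) ->
    (forall m, alive E m -> depth_le (@graded_maximal_ideal K n) I d) -> is_stanley_ideal I.
  move=> tE dE.
  have [r [u [Z [dec dZ]]]] := tiled_stanley_decomposition IE (tiled_ext aliveE tE).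
  exists r, u, Z; split=> // i fs fsm reg; apply: leq_trans (dZ i).
  apply: (dE (u i)) => //; apply/aliveE; case: dec => [H _ _]; apply: (H i).
  by exists 0%MM; rewrite ?addm0 // => j; rewrite mnm0E.
have conclude_low : (4 <= n)%N ->
   depth_le (@graded_maximal_ideal K n) I (n - 3) -> is_stanley_ideal I.
  by move=> n4 dI; apply: (conclude (n - 3)%N) => //; apply: tiled_first_edge EB (eq4_or_5 n4 hn).
have [[m [p [q [r [s [pq [rs [pr [ps [qr qs]]]]]]]]]]|no2] :=
  pselect (exists m p q r s, edge E m p q /\ edge E m r s /\ ~~ edge E m p r /\
    ~~ edge E m p s /\ ~~ edge E m q r /\ ~~ edge E m q s).
  apply: conclude_low; last exact: (depth_le_2K2 EB I_alive pq rs pr ps qr qs).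
  exact: uniq_size_le_ord (edge_2K2_uniq EB pq rs pr ps qr qs).
have [[m [p [q [r [s [t [[pq qr rs st tp] [pr ps qs qt rt]]]]]]]]|no5] :=
  pselect (exists m p q r s t,
    [/\ edge E m p q, edge E m q r, edge E m r s, edge E m s t & edge E m t p] /\
    [/\ ~~ edge E m p r, ~~ edge E m p s, ~~ edge E m q s, ~~ edge E m q t & ~~ edge E m r t]).
  have n5 := uniq_size_le_ord (edge_C5_uniq EB pq qr rs st tp pr ps qs qt rt).
  apply: conclude_low; first exact: ltnW n5.
  have -> : (n - 3 = 2)%N by rewrite (_ : n = 5) //; apply/eqP; rewrite eqn_leq hn.
  exact: (depth_le_C5 EB I_alive hn pq qr rs st tp pr ps qs qt rt).
apply: (conclude (n - 2)%N) => [|m [p [q pq]]]; last exact: (depth_le_edge EB I_alive pq).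
apply: tiled_cochordal EB hn _ _.
  by move=> m p q r s *; apply: no2; exists m, p, q, r, s; do !split.
by move=> m p q r s t *; apply: no5; exists m, p, q, r, s, t.
Qed.
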